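(* (Combinatorial completeness) Let $\nu=(\nu_s)_{s\ge1}$ be a sequence of non-negative integers with only finitely many nonzero terms, and let $W(\nu)=\bigotimes_{s\ge1}(W_s)^{\otimes\nu_s}$. (i) One has $$R(\nu)=\mathrm{ch}\,W(\nu),$$ $$\sum_{N}{}^{(\lambda)}R(\nu,N)=\dim W(\nu)_\lambda\qquad\text{for every }\lambda\in\mathbb{Z}\Lambda_1.$$ Here the sum $\sum_N^{(\lambda)}$ extends over all $N_1,N_2,\dots\in\mathbb{Z}_{\ge0}$ such that $\sum_{j\ge1}j(\nu_j-2N_j)\Lambda_1=\lambda$, and $\dim W(\nu)_\lambda$ denotes the multiplicity of the weight $\lambda$ in $W(\nu)$. In particular $R(\nu)$ is invariant under the Weyl group. (ii) (Kirillov) One has $$K(\nu)=(1-e^{-\alpha_1})\,\mathrm{ch}\,W(\nu),$$ $$\sum_{N}{}^{(\lambda)}K(\nu,N)=[W(\nu):V_\lambda]\qquad\text{for every }\lambda\in(\mathbb{Z}_{\ge0})\Lambda_1.$$ Here $[W(\nu):V_\lambda]$ denotes the multiplicity in $W(\nu)$ of the irreducible $U_q(\mathfrak{sl}(2))$-module $V_\lambda$ with highest weight $\lambda$, and the sum $\sum_N^{(\lambda)}$ is the same as in (i). In particular $e^{\Lambda_1}K(\nu)$ is skew-invariant under the Weyl group.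
   Context: $\alpha_1$ and $\Lambda_1$ are the simple root and the fundamental weight of $\mathfrak{sl}(2)$, $\alpha_1=2\Lambda_1$, and $x=e^{\Lambda_1}$ is a formal variable (so $e^{-\alpha_1}=x^{-2}$); the nontrivial element of the Weyl group acts by $x\mapsto x^{-1}$. $W_s$ is an $(s+1)$-dimensional irreducible $U_q(\widehat{\mathfrak{sl}}(2))$-module with highest weight $s\Lambda_1$. Its character with respect to the classical Cartan subalgebra is $\mathrm{ch}\,W_s=\frac{x^{s+1}-x^{-s-1}}{x-x^{-1}}$, so $\mathrm{ch}\,W(\nu)=\prod_{s\ge1}(\mathrm{ch}\,W_s)^{\nu_s}$. The symbol $\binom{\xi}{n}$ is the generalized binomial coefficient: $\binom{\xi}{n}=\xi(\xi-1)\cdots(\xi-n+1)/n!$ for integers $n\ge1$, $\binom{\xi}{0}=1$, and $0$ otherwise. For a sequence $N=(N_m)_{m\ge1}$ of non-negative integers with finitely many nonzero terms, put $$P_m=P_m(\nu,N)=\sum_{k\ge1}\min(m,k)\nu_k-2\sum_{k\ge1}\min(m,k)N_k,\qquad \mathcal{J}=\{j\ge1\mid N_j>0\}$$ (the $P_m$ may be negative). If $\mathcal{J}\neq\emptyset$, define $$R(\nu,N)=\det_{m,k\in\mathcal{J}}(F_{m,k})\prod_{m\in\mathcal{J}}\frac1{N_m}\binom{P_m+N_m-1}{N_m-1},\qquad F_{m,k}=\delta_{m,k}P_m+2\min(m,k)N_k,$$ and $R(\nu,N)=1$ if $\mathcal{J}=\emptyset$. Define also $$K(\nu,N)=\prod_{m\ge1}\binom{P_m+N_m}{N_m}.$$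 Finally put $$R(\nu)=\sum_N R(\nu,N)\,x^{\sum_{s\ge1}s\nu_s-2\sum_{j\ge1}jN_j},\qquad K(\nu)=\sum_N K(\nu,N)\,x^{\sum_{s\ge1}s\nu_s-2\sum_{j\ge1}jN_j},$$ formal series with finitely many positive powers of $x$, the sums being over all sequences $N$ of non-negative integers with finitely many nonzero terms. *)

(* Defs.v *)
From HB Require Import structures.
From mathcomp Require Import all_boot all_order all_algebra.
From mathcomp Require Import finmap mxtens.
From mathcomp Require Import all_classical.

Set Implicit Arguments.
Unset Strict Implicit.
Unset Printing Implicit Defensive.

Import Order.TTheory GRing.Theory Num.Theory.
Local Open Scope ring_scope.

(* Finite-dimensional modules over the quantum group U_q(A) of a symmetric
   generalized Cartan matrix A of size r (no derivation in the affine case).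
   A module is F^dim, viewed as column vectors, with the matrices by which the
   generators act; the inverse of k_i acts by invmx (qk i). *)
Record qmod (F : fieldType) (r : nat) := QMod {
  qdim : nat;
  qe : 'I_r -> 'M[F]_qdim;
  qf : 'I_r -> 'M[F]_qdim;
  qk : 'I_r -> 'M[F]_qdim }.
Arguments QMod {F r} qdim _ _ _.

Definition cartan_sl2 : 'M[int]_1 := \matrix_(i, j) 2.
Definition cartan_affine_sl2 : 'M[int]_2 :=
  \matrix_(i, j) (if i == j then 2 else - 2).

Section QuantumGroup.
Variables (F : fieldType) (q : F).

Definition qnum (n : nat) : F := (q ^+ n - q ^- n) / (q - q^-1).
Definition qfact (n : nat) : F := \prod_(i < n) qnum i.+1.
Definition qbinom (n m : nat) : F := qfact n / (qfact m * qfact (n - m)).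

(* With c = 1 - a_ij:
   sum_{m=0}^{c} (-1)^m [c choose m]_q X^{c-m} Y X^m. *)
Definition serre_sum (d : nat) (c : nat) (X Y : 'M[F]_d) : 'M[F]_d :=
  \sum_(m < c.+1)
     ((-1) ^+ m * qbinom c m) *: ((X ^+ (c - m)) *m Y *m (X ^+ m)).

Record is_qmodule (r : nat) (A : 'M[int]_r) (M : qmod F r) : Prop := {
  qk_unit : forall i, qk M i \in unitmx;
  qkk : forall i j, qk M i *m qk M j = qk M j *m qk M i;
  qke : forall i j, qk M i *m qe M j = q ^ (A i j) *: (qe M j *m qk M i);
  qkf : forall i j, qk M i *m qf M j = q ^ (- A i j) *: (qf M j *m qk M i);
  qef : forall i j, qe M i *m qf M j - qf M j *m qe M i =
          (if i == j then (q - q^-1)^-1 *: (qk M i - invmx (qk M i)) else 0);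
  qserre_e : forall i j, i != j ->
          serre_sum `|1 - A i j|%N (qe M i) (qe M j) = 0;
  qserre_f : forall i j, i != j ->
          serre_sum `|1 - A i j|%N (qf M i) (qf M j) = 0 }.

(* The row space of U encodes a subspace of F^dim; since the generators act on
   columns, they act on rows through their transposes. *)
Definition is_submodule (r : nat) (M : qmod F r) (U : 'M[F]_(qdim M)) : Prop :=
  forall i, [/\ stablemx U (qe M i)^T, stablemx U (qf M i)^T
              & stablemx U (qk M i)^T].

Definition irreducible (r : nat) (M : qmod F r) : Prop :=
  (0 < qdim M)%N /\
  forall U : 'M[F]_(qdim M), is_submodule U ->
    \rank U = 0%N \/ \rank U = qdim M.

Definition qiso (r : nat) (M N : qmod F r) : Prop :=
  exists (S : 'M[F]_(qdim N, qdim M)) (T : 'M[F]_(qdim M, qdim N)),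
    [/\ S *m T = 1%:M, T *m S = 1%:M
      & forall i, [/\ S *m qe M i = qe N i *m S, S *m qf M i = qf N i *m S
                    & S *m qk M i = qk N i *m S]].

(* Coproduct: e |-> e (x) 1 + k (x) e,  f |-> f (x) k^-1 + 1 (x) f,
   k |-> k (x) k. *)
Definition qtens (r : nat) (M N : qmod F r) : qmod F r :=
  QMod (qdim M * qdim N)
    (fun i => qe M i *t 1%:M + qk M i *t qe N i)
    (fun i => qf M i *t invmx (qk N i) + 1%:M *t qf N i)
    (fun i => qk M i *t qk N i).

Definition qtriv (r : nat) : qmod F r :=
  QMod 1 (fun=> 0) (fun=> 0) (fun=> 1%:M).

Definition qsum (r : nat) (M N : qmod F r) : qmod F r :=
  QMod (qdim M + qdim N)
    (fun i => block_mx (qe M i) 0 0 (qe N i))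
    (fun i => block_mx (qf M i) 0 0 (qf N i))
    (fun i => block_mx (qk M i) 0 0 (qk N i)).

Definition qzero (r : nat) : qmod F r :=
  QMod 0 (fun=> 0) (fun=> 0) (fun=> 0).

Definition qtens_seq (r : nat) (s : seq (qmod F r)) : qmod F r :=
  foldr (@qtens r) (qtriv r) s.
Definition qsum_seq (r : nat) (s : seq (qmod F r)) : qmod F r :=
  foldr (@qsum r) (qzero r) s.

(* Restriction to the classical subalgebra U_q(sl(2)), generated by e_1, f_1,
   k_1; the affine node is 0. *)
Definition classical (M : qmod F 2) : qmod F 1 :=
  QMod (qdim M) (fun=> qe M 1) (fun=> qf M 1) (fun=> qk M 1).

(* The weight n Lambda_1 is encoded by the integer n. *)
Definition weight_dim (M : qmod F 1) (n : int) : nat :=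
  \rank (eigenspace (qk M 0)^T (q ^ n)).

(* Every weight lies in n Lambda_1 - Z_{>=0} alpha_1, with alpha_1 = 2 Lambda_1. *)
Definition has_highest_weight (M : qmod F 1) (n : int) : Prop :=
  weight_dim M n != 0%N /\
  forall m : int, weight_dim M m != 0%N -> exists k : nat, m = n - 2 * k%:Z.

(* M is a direct sum of irreducibles, exactly m of which are isomorphic to V. *)
Definition decomposes_with (M V : qmod F 1) (m : nat) : Prop :=
  exists (n : nat) (L : 'I_n -> qmod F 1),
    (forall i, [/\ is_qmodule cartan_sl2 (L i), irreducible (L i)
                 & ~ qiso (L i) V]) /\
    qiso M (qsum_seq (nseq m V ++ codom L)).

(* [M : V] exists, is well defined, and equals m. *)
Definition multiplicity_is (M V : qmod F 1) (m : nat) : Prop :=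
  forall m' : nat, decomposes_with M V m' <-> m' = m.

End QuantumGroup.

(* Finitely supported sequences (N_m)_{m>=1} of naturals: the unused component
   of index 0 is set to 0, so that N m is N_m for m >= 1. *)
Definition fseq : Type := {N : {fsfun nat -> nat with 0%N} | N 0%N == 0%N}.
HB.instance Definition _ := Choice.on fseq.
Definition fseq_val (N : fseq) : nat -> nat := val N.
Coercion fseq_val : fseq >-> Funclass.
Definition fsupp (N : fseq) : seq nat := sort leq (finsupp (val N)).

Definition Wtensor (F : fieldType) (W : nat -> qmod F 2) (nu : fseq) :
    qmod F 2 :=
  qtens_seq (flatten [seq nseq (nu s) (W s) | s <- fsupp nu]).

Definition gbinom (xi n : int) : rat :=
  if n is Posz n' then (\prod_(i < n') (xi%:~R - i%:R)) / n'`!%:R else 0.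

Section Combinatorics.
Variable nu : fseq.

Definition Pnum (N : fseq) (m : nat) : int :=
  (\sum_(k <- fsupp nu) minn m k * nu k)%N%:Z
  - 2 * (\sum_(k <- fsupp N) minn m k * N k)%N%:Z.

Definition Fmat (N : fseq) (m k : nat) : int :=
  (if m == k then Pnum N m else 0) + 2 * (minn m k * N k)%N%:Z.

(* The set J is the support of N. *)
Definition Rnum (N : fseq) : rat :=
  let J := fsupp N in
  if J is [::] then 1 else
  (\det (\matrix_(a < size J, b < size J)
           Fmat N (nth 0%N J a) (nth 0%N J b)))%:~R
  * \prod_(m <- J)
      ((N m)%:R^-1 * gbinom (Pnum N m + (N m)%:Z - 1) ((N m)%:Z - 1)).

(* The factors with N_m = 0 are equal to 1. *)
Definition Knum (N : fseq) : rat :=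
  \prod_(m <- fsupp N) gbinom (Pnum N m + (N m)%:Z) (N m)%:Z.

Definition expo (N : fseq) : int :=
  (\sum_(s <- fsupp nu) s * nu s)%N%:Z
  - 2 * (\sum_(j <- fsupp N) j * N j)%N%:Z.

(* The range of the sum over N at weight lambda; it is a finite set, as
   sum_j j N_j is prescribed. *)
Definition at_weight (lambda : int) : set fseq := [set N | expo N = lambda].

End Combinatorics.

(* Formal series in x with finitely many positive powers, given by their
   coefficients: f n is the coefficient of x^n. The set-indexed sums below have
   finite support, as they must for the library's operator to be meaningful. *)
Definition fseries := int -> rat.
Definition xpow (k : int) : fseries := fun n => (n == k)%:R.
Definition smul (f g : fseries) : fseries :=
  fun n => \sum_(k \in [set: int]) f k * g (n - k).
Definition weyl (f : fseries) : fseries := fun n => f (- n).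

Definition sum_fseq (c : fseq -> rat) (e : fseq -> int) : fseries :=
  fun n => \sum_(N \in [set: fseq]) c N * xpow (e N) n.

Definition Rseries (nu : fseq) : fseries := sum_fseq (Rnum nu) (expo nu).
Definition Kseries (nu : fseq) : fseries := sum_fseq (Knum nu) (expo nu).

Definition character (F : fieldType) (q : F) (M : qmod F 1) : fseries :=
  fun n => (weight_dim q M n)%:R.

(* Main.v *)
(** A summand K(nu, N) or R(nu, N) depends on nu only through the numbers
    g_m = sum_k min(m, k) nu_k; let a(g, n) be the sum over all N with
    sum_j j N_j = n, for an arbitrary integer sequence g.  With mu_m = min(-, m),
    Pascal's rule (for R: multilinearity of the determinant) gives the linear form
      a(g + 2 mu_m, n) = a(g + mu_(m-1) + mu_(m+1), n) + a(g, n - m)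
    of the Q-system.  As the shifts by mu_m commute and are invertible, it implies
      a(g + mu_(m+1), n) = a(g + mu_1 + mu_m, n) - a(g + mu_(m-1), n - 1).
    Only g_1, ..., g_n matter for a(g, n), so all mu_m with m >= n act as one and
    the same shift, whence a(g + mu_1, n) = a(g, n) + a(g, n - 1) and then
    a(g + mu_s, n) = sum_(i <= s) a(g, n - i): tensoring with W_s multiplies the
    generating series by 1 + z + ... + z^s, z = x^-2.  The initial values are
    R(0, N) = 0 for N <> 0, because the rows of F sum to 0, and
    a((2n - 1) mu_1, n) = 0 for K, because the vacancy number at the largest m
    with N_m > 0 is then -1.

    On the representation side, e maps the weight space M_n onto M_(n+2) for
    n >= 0, so M has dim M_n - dim M_(n+2) independent singular vectors of weight
    n; they generate M, and counting dimensions shows that the sum of the simple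
    modules that they generate is direct. *)
Require Import Defs.
From mathcomp Require Import all_boot all_order all_algebra.
From mathcomp Require Import finmap mxtens all_classical.
From mathcomp Require Import zify ring lra.

Set Implicit Arguments.
Unset Strict Implicit.
Unset Printing Implicit Defensive.

Import Order.TTheory GRing.Theory Num.Theory.
Local Open Scope ring_scope.

Arguments gbinom : simpl never.

(** * Generalized binomial coefficients *)

Lemma gbinom0 x : gbinom x 0 = 1.
Proof. by rewrite /gbinom /= big_ord0 fact0 divr1. Qed.

Lemma gbinom_ltz0 x n : n < 0 -> gbinom x n = 0.
Proof. by case: n. Qed.

Lemma gbinomS x (n : nat) :
  gbinom x n.+1 = (x - n%:Z)%:~R / n.+1%:R * gbinom x n.
Proof.
rewrite /gbinom big_ord_recr /= factS natrM.
rewrite intrB invfM; ring.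
Qed.

Lemma gbinomSl x (n : nat) : gbinom x n.+1 = x%:~R / n.+1%:R * gbinom (x - 1) n.
Proof.
rewrite /gbinom big_ord_recl /= factS natrM subr0 invfM.
have e i : x%:~R - i.+1%:R = (x - 1)%:~R - i%:R :> rat.
  by rewrite intrB -natr1; ring.
under eq_bigr => i _ do rewrite e.
by ring.
Qed.

Lemma gbinomB1 x n : gbinom x n = gbinom (x - 1) n + gbinom (x - 1) (n - 1).
Proof.
case: n => [[|n]|n] //; first by rewrite !gbinom0 gbinom_ltz0 ?addr0.
have -> : n.+1%:Z - 1 = n by lia.
rewrite gbinomSl gbinomS !intrB -!pmulrn.
have n0 : n.+1%:R != 0 :> rat by rewrite pnatr_eq0.
rewrite -natr1 in n0 *.
by field.
Qed.

Lemma gbinom_nat (m n : nat) : (m < n)%N -> gbinom m n = 0.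
Proof.
move=> mn; rewrite /gbinom (bigD1 (Ordinal mn)) //=.
by rewrite subrr !mul0r.
Qed.

(** At x = P + N this turns the diagonal binomial of [Rentry] into P / N times the other binomial
    there, which is how F_(m,m) reappears. *)
Lemma gbinom_pred x (n : nat) : (0 < n)%N ->
  gbinom (x - 1) n%:Z = n%:R^-1 * (x - n%:Z)%:~R * gbinom (x - 1) (n%:Z - 1).
Proof.
case: n => // n _; have -> : n.+1%:Z - 1 = n by lia.
rewrite gbinomS [_^-1 * _]mulrC; have -> // : x - 1 - n%:Z = x - n.+1%:Z by lia.
Qed.

(** * Linearization of the Q-system *)

(** The change of g when one tensor factor W_m is added. *)
Definition mu (m : nat) : nat -> int := fun j => (minn j m)%:Z.

Section QSystem.
Variables (L : nat) (a : (nat -> int) -> int -> rat).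
Hypothesis L_gt0 : (0 < L)%N.
Hypothesis a_ext : forall g h n, (forall j, (j < L)%N -> g j = h j) -> a g n = a h n.
Hypothesis a_Qsys : forall g (m : nat) n, (0 < m)%N -> n < L%:Z ->
  a (g \+ mu m \+ mu m) n = a (g \+ mu m.-1 \+ mu m.+1) n + a g (n - m%:Z).

Lemma Qsys_linear m g n : (0 < m)%N -> n < L%:Z ->
  a (g \+ mu m.+1) n = a (g \+ mu 1 \+ mu m) n - a (g \+ mu m.-1) (n - 1).
Proof.
move=> m0 nL; elim: m m0 g => // [[|m]] IH _ g.
  rewrite a_Qsys //.
  rewrite (@a_ext (g \+ mu 0) g) => [|j _]; last by rewrite /= /mu minn0 addr0.
  rewrite addrK; apply: a_ext => j _.
  by rewrite /= /mu minn0 addr0.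
(* The induction hypothesis is taken at d + mu_(m+2). The Q-system relation rewrites its left side
   at level n and its last term at level n - 1; both times the remainder is a(d, n - m - 2), and the
   two cancel. *)
set d : nat -> int := fun j => g j - mu m.+1 j.
have := IH isT (d \+ mu m.+2).
rewrite a_Qsys //=.
have -> : a (d \+ mu m.+1 \+ mu m.+3) n = a (g \+ mu m.+3) n.
  by apply: a_ext => j _; rewrite /= subrK.
have -> : a (d \+ mu m.+2 \+ mu 1 \+ mu m.+1) n = a (g \+ mu 1 \+ mu m.+2) n.
  by apply: a_ext => j _; rewrite /= /d; ring.
have := @a_Qsys d m.+1 (n - 1) isT.
have -> : a (d \+ mu m.+1 \+ mu m.+1) (n - 1) = a (g \+ mu m.+1) (n - 1).
  by apply: a_ext => j _; rewrite /= subrK.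
have -> : a (d \+ mu m.+2 \+ mu m) (n - 1) = a (d \+ mu m \+ mu m.+2) (n - 1).
  by apply: a_ext => j _; rewrite /=; ring.
have -> : n - 1 - m.+1%:Z = n - m.+2%:Z by lia.
move=> -> /=; last by lia.
lra.
Qed.

(* [mu L] and [mu L.+1] agree below [L], so the linear recursion at [L] involves
   a single shift; it is applied at [g - mu L]. *)
Lemma Qsys_mu1 g n : n < L%:Z -> a (g \+ mu 1) n = a g n + a g (n - 1).
Proof.
move=> nL; set d : nat -> int := fun j => g j - mu L j.
have := @Qsys_linear L d n L_gt0 nL.
have -> : a (d \+ mu L.+1) n = a g n.
  by apply: a_ext => j jL; rewrite /= /d /mu; lia.
have -> : a (d \+ mu 1 \+ mu L) n = a (g \+ mu 1) n.
  by apply: a_ext => j jL; rewrite /= /d /mu; lia.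
have -> : a (d \+ mu L.-1) (n - 1) = a g (n - 1).
  by apply: a_ext => j jL; rewrite /= /d /mu; lia.
by move=> ->; rewrite subrK.
Qed.

(** If z lowers the level by one, the two-step induction is the identity (1 + z)(1 + ... + z^(s+1))
    - z(1 + ... + z^s) = 1 + ... + z^(s+2). *)
Lemma Qsys_mu s g n : n < L%:Z ->
  a (g \+ mu s) n = \sum_(i < s.+1) a g (n - i%:Z).
Proof.
have a0 h k : a (h \+ mu 0) k = a h k.
  by apply: a_ext => j _; rewrite /= /mu minn0 addr0.
elim/ltn_ind: s g n => [[|[|s]]] IH g n nL.
- by rewrite big_ord1 a0 subr0.
- by rewrite !big_ord_recl big_ord0 addr0 Qsys_mu1 // subr0.
have -> : \sum_(i < s.+3) a g (n - i%:Z)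
    = a g n + a g (n - 1) + \sum_(i < s.+1) a g (n - 1 - i.+1%:Z).
  rewrite [LHS]big_ord_recl [X in _ + X = _]big_ord_recl subr0 addrA; congr (_ + _ + _).
    by apply: eq_bigr => i _; congr (a g _); rewrite /= /bump; lia.
rewrite Qsys_linear //= !IH //; last by lia.
rewrite [in X in X - _]big_ord_recl subr0 Qsys_mu1 //.
have -> : \sum_(i < s.+1) a (g \+ mu 1) (n - (bump 0 i)%:Z) =
    \sum_(i < s.+1) a g (n - 1 - i%:Z) + \sum_(i < s.+1) a g (n - 1 - i.+1%:Z).
  rewrite -big_split /=; apply: eq_bigr => i _; rewrite Qsys_mu1; last by lia.
  by congr (a g _ + a g _); rewrite /= /bump; lia.
by rewrite addrA addrAC addrK.
Qed.

End QSystem.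

(** * Vacancy numbers and the summands K and R for an arbitrary g *)

(** The vacancy number P_m, with g in place of sum_k min(m, k) nu_k. The cut-off is harmless once
    [L] exceeds sum_j j N_j, since then N vanishes from [L] on. *)
Definition vac (L : nat) (g : nat -> int) (N : nat -> nat) (m : nat) : int :=
  g m - 2 * (\sum_(k < L) minn m k * N k)%N%:Z.

Definition add1at (m : nat) (N : nat -> nat) : nat -> nat :=
  fun k => (N k + (k == m))%N.

Lemma sum_add1at L m N (w : nat -> nat) : (m < L)%N ->
  (\sum_(k < L) w k * add1at m N k = \sum_(k < L) w k * N k + w m)%N.
Proof.
move=> mL; under eq_bigr => k _ do rewrite mulnDr.
rewrite big_split /=; congr (_ + _)%N.
rewrite (bigD1 (Ordinal mL)) //= eqxx muln1 big1 ?addn0 // => k kNm.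
by rewrite (_ : (k == m :> nat) = false) ?muln0 //; apply/negbTE; exact: kNm.
Qed.

Lemma vac_add1at L g m N j : (m < L)%N ->
  vac L (g \+ mu m \+ mu m) (add1at m N) j = vac L g N j.
Proof. by move=> mL; rewrite /vac /= (sum_add1at _ (minn j)) // /mu !PoszD; ring. Qed.

(** The second difference of min(j, -) at m is - 1 if j = m and 0 otherwise, so only the vacancy
    number at m moves. *)
Lemma vac_mu_pred_succ L g m N j : (0 < m)%N ->
  vac L (g \+ mu m.-1 \+ mu m.+1) N j =
  vac L (g \+ mu m \+ mu m) N j - (j == m)%:Z.
Proof. by move=> m0; rewrite /vac /= /mu; case: eqVneq => jm /=; lia. Qed.

(** The index m = 0 contributes the factor 1 because N 0 = 0 for the sequences summed over. *)
Definition Kterm (L : nat) (g : nat -> int) (N : nat -> nat) : rat :=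
  \prod_(m < L) gbinom (vac L g N m + (N m)%:Z) (N m)%:Z.

(* Entry of the matrix whose determinant is R(nu, N), with the factor
   binom(P + N - 1, N - 1) / N distributed over the columns; a column with
   N = 0 is then a unit vector, which makes the size of the matrix irrelevant.
   In Rterm the matrix is transposed. *)
Definition Rentry (p n : int) (j k : nat) : rat :=
  (k == j)%:R * gbinom (p + n - 1) n + (2 * minn j k)%:R * gbinom (p + n - 1) (n - 1).

Definition Rterm (L : nat) (g : nat -> int) (N : nat -> nat) : rat :=
  \det (\matrix_(k < L, j < L) Rentry (vac L g N k) (N k) j k).

(** Pascal's rule in both binomials at once; it makes a row of the matrix of [Rterm] split as a
    factor of [Kterm] does. *)
Lemma RentryB1 p n j k :
  Rentry p n j k = Rentry (p - 1) n j k + Rentry p (n - 1) j k.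
Proof.
rewrite /Rentry (gbinomB1 (p + n - 1) n) (gbinomB1 (p + n - 1) (n - 1)).
have -> : p - 1 + n - 1 = p + n - 1 - 1 by ring.
have -> : p + (n - 1) - 1 = p + n - 1 - 1 by ring.
ring.
Qed.

Lemma Rentry_N0 p j k : Rentry p 0 j k = (k == j)%:R.
Proof. by rewrite /Rentry gbinom0 gbinom_ltz0 // mulr0 addr0 mulr1. Qed.

(** What K and R have in common: locality in g and Pascal's rule at m. If N_m = 0 the summand does
    not see P_m; otherwise the remainder is the summand of N with one part m removed. *)
Definition Qterm L (t : (nat -> int) -> (nat -> nat) -> rat) : Prop :=
  [/\ forall g h N, (forall j, (j < L)%N -> g j = h j) -> t g N = t h N,
      forall g (m : nat) N, (0 < m < L)%N -> N m = 0%N ->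
        t (g \+ mu m \+ mu m) N = t (g \+ mu m.-1 \+ mu m.+1) N
    & forall g (m : nat) N, (0 < m < L)%N ->
        t (g \+ mu m \+ mu m) (add1at m N)
        = t (g \+ mu m.-1 \+ mu m.+1) (add1at m N) + t g N].

(** Only the factor at m distinguishes the three products, and there the claim is Pascal's rule. *)
Lemma Kterm_Qterm L : Qterm L (Kterm L).
Proof.
split=> [g h N gh|g m N /andP[m0 mL] Nm|g m N /andP[m0 mL]].
- by apply: eq_bigr => j _; rewrite /vac gh.
- apply: eq_bigr => j _; rewrite vac_mu_pred_succ //.
  have [->|_] := eqVneq (j : nat) m; last by rewrite subr0.
  by rewrite Nm !gbinom0.
have D h N' : Kterm L h N' = gbinom (vac L h N' m + (N' m)%:Z) (N' m)%:Z *
    \prod_(i < L | i != Ordinal mL) gbinom (vac L h N' i + (N' i)%:Z) (N' i)%:Z.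
  by rewrite /Kterm (bigD1 (Ordinal mL)).
rewrite !D.
have e : \prod_(i < L | i != Ordinal mL)
    gbinom (vac L (g \+ mu m.-1 \+ mu m.+1) (add1at m N) i + (add1at m N i)%:Z)
      (add1at m N i)%:Z =
    \prod_(i < L | i != Ordinal mL) gbinom (vac L g N i + (N i)%:Z) (N i)%:Z.
  apply: eq_bigr => i im; rewrite vac_mu_pred_succ // vac_add1at //.
  by rewrite /add1at (_ : (i == m :> nat) = false) ?subr0 ?addn0 //; apply/negbTE.
have e' : \prod_(i < L | i != Ordinal mL)
    gbinom (vac L (g \+ mu m \+ mu m) (add1at m N) i + (add1at m N i)%:Z)
      (add1at m N i)%:Z =
    \prod_(i < L | i != Ordinal mL) gbinom (vac L g N i + (N i)%:Z) (N i)%:Z.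
  apply: eq_bigr => i im; rewrite vac_add1at //.
  by rewrite /add1at (_ : (i == m :> nat) = false) ?addn0 //; apply/negbTE.
rewrite e e' -mulrDl; congr (_ * _).
rewrite vac_mu_pred_succ // vac_add1at // /add1at eqxx addn1.
rewrite gbinomB1; congr (gbinom _ _ + gbinom _ _); lia.
Qed.

(** The three matrices agree outside row m, where [RentryB1] applies; the determinant is linear in
    that row. *)
Lemma Rterm_Qterm L : Qterm L (Rterm L).
Proof.
split=> [g h N gh|g m N /andP[m0 mL] Nm|g m N /andP[m0 mL]].
- by congr (\det _); apply/matrixP => k j; rewrite !mxE /vac gh.
- congr (\det _); apply/matrixP => k j; rewrite !mxE vac_mu_pred_succ //.
  have [->|_] := eqVneq (k : nat) m; last by rewrite subr0.
  by rewrite Nm !Rentry_N0.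
pose i0 := Ordinal mL.
have off (i : 'I_L.-1) : (lift i0 i == m :> nat) = false.
  by rewrite -[m]/(nat_of_ord i0) eq_sym (inj_eq val_inj) (negbTE (neq_lift _ _)).
rewrite -[X in X + _]mul1r -[X in _ + X]mul1r.
apply: (@determinant_multilinear _ _ _ _ _ i0).
- rewrite !scale1r; apply/rowP => j; rewrite !mxE vac_mu_pred_succ // vac_add1at //.
  by rewrite /= /add1at eqxx addn1 RentryB1; congr (_ + Rentry _ _ _ _); lia.
- apply/matrixP => i j; rewrite !mxE vac_mu_pred_succ //.
  by rewrite off subr0.
- apply/matrixP => i j; rewrite !mxE vac_add1at //.
  by rewrite /add1at off addn0.
Qed.

(** * Finitely supported sequences as partitions *)

Lemma mem_fsupp (N : fseq) j : (j \in fsupp N) = (N j != 0%N).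
Proof. by rewrite mem_sort mem_finsupp. Qed.

Lemma fsupp_uniq (N : fseq) : uniq (fsupp N).
Proof. by rewrite sort_uniq fset_uniq. Qed.

Lemma fseq0 (N : fseq) : N 0%N = 0%N.
Proof. exact: (eqP (valP N)). Qed.

Lemma fseqP (M N : fseq) : M =1 N -> M = N.
Proof. by move=> MN; apply/val_inj/fsfunP. Qed.

Lemma big_fsupp (R : Type) (idx : R) (op : Monoid.com_law idx) (N : fseq)
    (L : nat) (F : nat -> R) :
  (forall j, (L <= j)%N -> N j = 0%N) -> (forall j, N j = 0%N -> F j = idx) ->
  \big[op/idx]_(j <- fsupp N) F j = \big[op/idx]_(j < L) F j.
Proof.
move=> NL F0; rewrite -(big_mkord xpredT F) /index_iota subn0.
rewrite [RHS](bigID (fun j => N j != 0%N)) /= [X in op _ X]big1 ?Monoid.mulm1.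
  rewrite -[RHS]big_filter; apply/perm_big/uniq_perm; rewrite ?fsupp_uniq //.
    by rewrite filter_uniq ?iota_uniq.
  move=> j; rewrite mem_fsupp mem_filter mem_iota add0n /=.
  have [//|Nj] := eqVneq (N j) 0%N; apply/esym; rewrite ltnNge.
  by apply: contraNN Nj => /NL ->.
by move=> j /negbNE/eqP/F0.
Qed.

Definition fsize (N : fseq) : nat := (\sum_(j <- fsupp N) j * N j)%N.

Lemma fsize_gt (N : fseq) j : (fsize N < j)%N -> N j = 0%N.
Proof.
move=> Nj; apply/eqP; apply: contraLR Nj => Nj; rewrite -leqNgt /fsize.
rewrite (bigD1_seq j) ?mem_fsupp ?fsupp_uniq //=.
by apply: leq_trans (leq_addr _ _); rewrite leq_pmulr // lt0n.
Qed.

Lemma fsizeE (N : fseq) L : (fsize N < L)%N -> fsize N = (\sum_(j < L) j * N j)%N.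
Proof.
move=> NL; apply: big_fsupp => j; last by move=> ->; rewrite muln0.
by move=> Lj; apply: fsize_gt; apply: leq_trans NL Lj.
Qed.

(** [insubd] falls back to N when the update would put a nonzero value at index 0; hence the
    condition 0 < m below. *)
Definition fseq_upd (N : fseq) (m v : nat) : fseq :=
  insubd N [fsfun val N with m |-> v].

Lemma fseq_updE (N : fseq) m v j : (0 < m)%N ->
  fseq_upd N m v j = if j == m then v else N j.
Proof.
move=> m0; rewrite /fseq_val /fseq_upd insubdK ?fsfun_withE // unfold_in /=.
by rewrite fsfun_withE (ltn_eqF m0) -/(fseq_val N 0%N) fseq0.
Qed.

Lemma fsize_upd (N : fseq) m v : (0 < m)%N ->
  (fsize (fseq_upd N m v) + m * N m = fsize N + m * v)%N.
Proof.
move=> m0; set M := fseq_upd _ _ _; pose L := (fsize N + fsize M + m).+1.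
have mL : (m < L)%N by rewrite /L; lia.
have D (K : fseq) : (fsize K < L)%N ->
    fsize K = (m * K m + \sum_(i < L | i != Ordinal mL) i * K i)%N.
  by move=> KL; rewrite (fsizeE KL) (bigD1 (Ordinal mL)).
have NL : (fsize N < L)%N by rewrite /L; lia.
have ML : (fsize M < L)%N by rewrite /L; lia.
rewrite (D N NL) (D M ML).
rewrite [M m]fseq_updE // eqxx addnAC [RHS]addnAC [(m * N m + _)%N]addnC.
congr (_ + _)%N; apply: eq_bigr => i im.
by rewrite fseq_updE // (_ : (i == m :> nat) = false) //; apply/negbTE.
Qed.

Definition of_fsize (n : int) : set fseq := [set N | (fsize N)%:Z = n]%classic.

(** A partition of n has parts and multiplicities at most n, so it is determined by a function from
    ['I_n.+1] to itself. *)
Lemma of_fsize_finite n : finite_set (of_fsize n).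
Proof.
case: n => n; last by rewrite (_ : of_fsize _ = set0) //; apply/seteqP; split.
pose f (N : fseq) := (fsize N, [ffun i : 'I_n.+1 => inord (N i) : 'I_n.+1]).
rewrite (_ : of_fsize n = f @^-1` ([set n] `*` setT))%classic; last first.
  by apply/seteqP; split=> N /=; [case=> ->|case=> <-].
apply: finite_preimage; last exact: finite_setX.
move=> M N; rewrite !inE /= => -[Mn _] [Nn _] [_ /ffunP MN]; apply: fseqP => j.
have [jn|nj] := ltnP j n.+1; last by rewrite !fsize_gt // ?Mn ?Nn.
have := MN (Ordinal jn); rewrite !ffunE /= => /(congr1 (@nat_of_ord _)).
have lt K : fsize K = n -> (K j < n.+1)%N.
  move=> Kn; rewrite ltnS; have [->|j0] := posnP j; first by rewrite fseq0.
  have [->//|Kj] := posnP (K j).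
  rewrite -Kn /fsize (bigD1_seq j) ?mem_fsupp ?fsupp_uniq -?lt0n //=.
  by apply: leq_trans (leq_addr _ _); rewrite leq_pmull.
by rewrite !inordK ?lt.
Qed.

(** * Sums over all partitions of a given size *)

Definition level_sum (t : (nat -> int) -> (nat -> nat) -> rat)
  (g : nat -> int) (n : int) : rat := \sum_(N \in of_fsize n) t g (fseq_val N).

Section LevelSum.
Variables (L : nat) (t : (nat -> int) -> (nat -> nat) -> rat).
Hypothesis tQ : Qterm L t.

Lemma level_sum_neg g n : n < 0 -> level_sum t g n = 0.
Proof. by move=> n0; apply: fsbig1 => N /= Nn; move: n0; rewrite -Nn. Qed.

Lemma level_sum_ext g h n : (forall j, (j < L)%N -> g j = h j) ->
  level_sum t g n = level_sum t h n.
Proof. by case: tQ => te _ _ gh; apply: eq_fsbigr => N _; apply: te. Qed.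

(** The partitions are split by whether they contain the part m; removing one such part accounts for
    the last term. *)
Lemma level_sum_Qsys g m n : (0 < m)%N -> n < L%:Z ->
  level_sum t (g \+ mu m \+ mu m) n
  = level_sum t (g \+ mu m.-1 \+ mu m.+1) n + level_sum t g (n - m%:Z).
Proof.
move=> m0 nL; have [mL|Lm] := ltnP m L; last first.
  (* Here n - m < 0, and [mu m.-1], [mu m] and [mu m.+1] agree below [L]. *)
  rewrite [X in _ + X]level_sum_neg ?addr0; last by lia.
  by apply: level_sum_ext => j jL; rewrite /= /mu; lia.
case: tQ => _ t0 t1.
pose B : set fseq := [set N : fseq | N m != 0%N]%classic.
rewrite /level_sum (fsbigID B) ?[X in _ = X + _](fsbigID B) //; try exact: of_fsize_finite.
rewrite -addrA [X in _ = _ + X]addrC addrA; congr (_ + _); last first.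
  apply: eq_fsbigr => N; rewrite inE => -[_ /= /negP/negbNE/eqP Nm].
  by rewrite t0 ?m0.
(* Adding one part m identifies the partitions of n - m with the partitions of n that contain m. *)
have bij : set_bij (of_fsize (n - m%:Z)) (of_fsize n `&` B)%classic
    (fun N => fseq_upd N m (N m).+1).
  split=> [N /= Nn|M N _ _ MN|N [/= Nn Nm]].
  - split; last by rewrite /B /= fseq_updE // eqxx.
    have := fsize_upd N (N m).+1 m0; rewrite mulnS /of_fsize /=; move: Nn; rewrite /of_fsize /=; lia.
  - apply: fseqP => j; have := congr1 (fun N : fseq => N j) MN.
    by rewrite !fseq_updE //; case: eqP => // -> [].
  - exists (fseq_upd N m (N m).-1).
      have := fsize_upd N (N m).-1 m0; move: Nn Nm; rewrite /of_fsize /B /=; case: (N m) => //= k.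
      by rewrite mulnS; lia.
    apply: fseqP => j; rewrite !fseq_updE // eqxx prednK ?lt0n //.
    by case: eqP => [->|].
rewrite !(reindex_fsbig _ _ _ _ bij) -fsbig_split /=; last exact: of_fsize_finite.
apply: eq_fsbigr => /= N _.
have -> : fseq_val (fseq_upd N m (N m).+1) = add1at m N :> (nat -> nat).
  apply/funext => j; rewrite fseq_updE // /add1at.
  by case: eqP => [->|]; rewrite ?addn1 ?addn0.
by rewrite t1 ?m0.
Qed.

Lemma level_sum_mu s g n : (0 < L)%N -> n < L%:Z ->
  level_sum t (g \+ mu s) n = \sum_(i < s.+1) level_sum t g (n - i%:Z).
Proof.
move=> L0; apply: Qsys_mu => //; [exact: level_sum_ext|exact: level_sum_Qsys].
Qed.

End LevelSum.

(** * Reduction of the determinant to the support of N *)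

Definition det_seq n (A : nat -> nat -> rat) (s : seq nat) : rat :=
  \det (\matrix_(a < n, b < n) A (nth 0%N s a) (nth 0%N s b)).

(** Laplace expansion along the row of x, a unit vector; its nonzero entry is on the diagonal, so
    the cofactor sign is 1. *)
Lemma det_seq_rem n (A : nat -> nat -> rat) (s1 s2 : seq nat) x :
  size (s1 ++ s2) = n -> uniq (s1 ++ x :: s2) ->
  (forall y, A x y = (x == y)%:R) ->
  det_seq n.+1 A (s1 ++ x :: s2) = det_seq n A (s1 ++ s2).
Proof.
move=> sz us Ax; have ltn : (size s1 < n.+1)%N by rewrite -sz size_cat ltnS leq_addr.
pose i0 := Ordinal ltn.
have nth0 : nth 0%N (s1 ++ x :: s2) (size s1) = x by rewrite nth_cat ltnn subnn.
have sz1 : size (s1 ++ x :: s2) = n.+1 by rewrite -sz !size_cat /= addnS.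
rewrite /det_seq (expand_det_row _ i0) (bigD1 i0) //= big1 ?addr0; last first.
  move=> j ji; rewrite !mxE nth0 Ax -[X in X == _]nth0 nth_uniq ?sz1 //.
  by rewrite eq_sym (_ : (j == size s1 :> nat) = false) ?mul0r //; apply/negbTE.
rewrite !mxE nth0 Ax eqxx mul1r /cofactor addnn -signr_odd odd_double mul1r.
have nthl (a : 'I_n) : nth 0%N (s1 ++ x :: s2) (lift i0 a) = nth 0%N (s1 ++ s2) a.
  rewrite !nth_cat /= /bump; have [a1|a1] := leqP (size s1) a.
    by rewrite add1n ltnNge leqW //= subSn.
  by rewrite add0n a1.
by congr (\det _); apply/matrixP => a b; rewrite !mxE !nthl.
Qed.

(** The prefix [s1] holds the indices already kept, which makes the induction on [s2] go through. *)
Lemma det_seq_filter (A : nat -> nat -> rat) (p : pred nat) (s1 s2 : seq nat) :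
  uniq (s1 ++ s2) -> (forall x y, ~~ p x -> A x y = (x == y)%:R) ->
  det_seq (size (s1 ++ s2)) A (s1 ++ s2) =
  det_seq (size (s1 ++ [seq x <- s2 | p x])) A (s1 ++ [seq x <- s2 | p x]).
Proof.
move=> us Ap; elim: s2 s1 us => [//|x s2 IH] s1 us /=.
case px: (p x); first by rewrite -!cat_rcons IH // cat_rcons.
have u2 : uniq (s1 ++ s2).
  by move: us; rewrite -cat1s uniq_catCA /= => /andP[].
rewrite -IH // size_cat /= addnS -size_cat det_seq_rem // => y.
by rewrite Ap ?px.
Qed.

Lemma fsuppE (N : fseq) L : (fsize N < L)%N ->
  fsupp N = [seq j <- iota 0 L | N j != 0%N].
Proof.
move=> NL; apply: (sorted_eq leq_trans anti_leq).
- exact: (sort_sorted leq_total).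
- by apply: sorted_filter; [exact: leq_trans|exact: iota_sorted].
apply: uniq_perm; rewrite ?fsupp_uniq ?filter_uniq ?iota_uniq // => j.
rewrite mem_fsupp mem_filter mem_iota add0n /=.
have [//|Nj] := eqVneq (N j) 0%N; apply/esym; rewrite ltnNge.
by apply: contraNN Nj => Lj; rewrite fsize_gt // (leq_trans NL Lj).
Qed.

(** Rows of index outside the support are unit vectors and drop out. In what remains, row k is
    binom(P_k + N_k - 1, N_k - 1) / N_k times column k of F. *)
Lemma Rterm_fsupp L g (N : fseq) : (fsize N < L)%N ->
  let J := fsupp N in
  Rterm L g N =
  (\det (\matrix_(a < size J, b < size J)
     let m := nth 0%N J a in let k := nth 0%N J b in
     (if m == k then vac L g N m else 0) + 2 * (minn m k * N k)%N%:Z))%:~R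
  * \prod_(m <- J)
      ((N m)%:R^-1 * gbinom (vac L g N m + (N m)%:Z - 1) ((N m)%:Z - 1)).
Proof.
move=> NL J.
pose A k j := Rentry (vac L g N k) (N k) j k.
have -> : Rterm L g N = det_seq L A (iota 0 L).
  by congr (\det _); apply/matrixP => k j; rewrite !mxE /A !nth_iota.
have := @det_seq_filter A (fun j => N j != 0%N) [::] (iota 0 L) (iota_uniq _ _).
rewrite cat0s size_iota /= -fsuppE // => ->; last first.
  by move=> x y /negbNE/eqP Nx; rewrite /A Nx Rentry_N0.
rewrite -/J; pose c m := (N m)%:R^-1 * gbinom (vac L g N m + (N m)%:Z - 1) ((N m)%:Z - 1).
(* The scalars are collected in a diagonal matrix, multiplied from the left with the transpose of
   F. *)
rewrite (big_nth 0%N) big_mkord mulrC -det_map_mx -det_tr.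
pose d := \row_(a < size J) c (nth 0%N J a).
have -> : \prod_(i < size J) c (nth 0%N J i) = \det (diag_mx d).
  by rewrite det_diag; apply: eq_bigr => i _; rewrite mxE.
rewrite -det_mulmx mul_diag_mx; congr (\det _); apply/matrixP => a b.
rewrite !mxE /A /c; set k := nth 0%N J a; set j := nth 0%N J b.
have : k \in J by exact: mem_nth.
rewrite mem_fsupp -lt0n => Nk.
rewrite /Rentry gbinom_pred // addrK.
rewrite [j == k]eq_sym /=; set b1 := gbinom _ _.
have Nk0 : (N k)%:R != 0 :> rat by rewrite pnatr_eq0 -lt0n.
have -> : ((if k == j then vac L g N j else 0) + 2 * (minn j k * N k)%N%:Z)%:~R
    = (k == j)%:R * (vac L g N k)%:~R + (2 * minn j k)%:R * (N k)%:R :> rat.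
  rewrite rmorphD /=; congr (_ + _); last by rewrite -natrM -mulnA -pmulrn.
  by case: eqVneq => [->|_]; rewrite ?mul1r ?mul0r.
by field.
Qed.

(** * Initial values: the empty tensor product *)

Lemma Rterm0 L (N : fseq) : (0 < fsize N < L)%N -> Rterm L (fun=> 0) N = 0.
Proof.
case/andP => N0 NL; rewrite Rterm_fsupp //= -det_map_mx -det_tr.
set B := (_^T)%R; suff -> : \det B = 0 by rewrite mul0r.
have J0 : (0 < size (fsupp N))%N.
  by rewrite lt0n; apply: contraTneq N0 => /size0nil J0; rewrite /fsize J0 big_nil.
(* For g = 0 one has P_m = - 2 sum_k min(m, k) N_k, which cancels the rest of row m of F. The
   transpose is there because [det0P] asks for a row vector. *)
apply/eqP/det0P; exists (const_mx 1).
  by apply/eqP => /rowP /(_ (Ordinal J0)); rewrite !mxE => /eqP; rewrite oner_eq0.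
apply/rowP => a; rewrite !mxE.
under eq_bigr => b _ do rewrite !mxE mul1r.
rewrite -rmorph_sum big_split /= -[X in _ + X]mulr_sumr.
rewrite (bigD1 a) //= eqxx big1 ?addr0; last first.
  by move=> b ba; rewrite nth_uniq ?fsupp_uniq // eq_sym (inj_eq val_inj) (negbTE ba).
set m := nth _ _ _.
have -> : \sum_(b < size (fsupp N)) (minn m (nth 0%N (fsupp N) b) * N (nth 0%N (fsupp N) b))%N%:Z
   = (\sum_(k < L) minn m k * N k)%N%:Z.
  rewrite -(@big_fsupp _ _ _ N L (fun k => minn m k * N k)%N).
  - by rewrite (big_nth 0%N) big_mkord (big_morph Posz PoszD (erefl _)).
  - by move=> j Lj; apply: fsize_gt; apply: leq_trans NL Lj.
  - by move=> j ->; rewrite muln0.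
by rewrite /vac sub0r addNr.
Qed.

Lemma fsize_eq0 (N : fseq) : fsize N = 0%N -> N =1 fun=> 0%N.
Proof.
by move=> N0 [|j]; [exact: fseq0|apply: fsize_gt; rewrite N0].
Qed.

Lemma fseq_nil_subproof : ([fsfun] : {fsfun nat -> nat with 0%N}) 0%N == 0%N.
Proof. by rewrite fsfunE. Qed.

Definition fseq_nil : fseq :=
  @exist {fsfun nat -> nat with 0%N} (fun N => N 0%N == 0%N) _ fseq_nil_subproof.

Lemma fseq_nilE : fseq_nil =1 fun=> 0%N.
Proof. by move=> j; rewrite /fseq_val /= fsfunE. Qed.

Lemma fsize_nil : fsize fseq_nil = 0%N.
Proof.
by rewrite /fsize big_seq big1 // => j _; rewrite fseq_nilE muln0.
Qed.

Lemma level_sum0 t g : level_sum t g 0 = t g (fun=> 0%N).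
Proof.
rewrite /level_sum (_ : of_fsize 0 = [set fseq_nil])%classic; last first.
  apply/seteqP; split=> [N /= [/fsize_eq0 N0]|N /= ->]; last by rewrite /of_fsize /= fsize_nil.
  by apply: fseqP => j; rewrite N0 fseq_nilE.
by rewrite fsbig_set1; congr (t g _); apply/funext/fseq_nilE.
Qed.

Lemma level_sum_Rterm0 L n : n < L%:Z -> level_sum (Rterm L) (fun=> 0) n = (n == 0)%:R.
Proof.
move=> nL; have [->|n0] := eqVneq n 0.
  rewrite level_sum0 /Rterm -[RHS](det1 _ L); congr (\det _).
  by apply/matrixP => i j; rewrite !mxE Rentry_N0.
apply: fsbig1 => N /= Nn; apply: Rterm0; move: nL n0; rewrite -Nn; lia.
Qed.

Lemma gbinom_binomial (m n : nat) : gbinom m n = 'C(m, n)%:R.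
Proof.
elim: m n => [|m IH] [|n]; rewrite ?gbinom0 ?bin0 //; first by rewrite gbinom_nat.
rewrite gbinomB1 binS natrD.
have -> : m.+1%:Z - 1 = m by lia.
have -> : n.+1%:Z - 1 = n by lia.
by rewrite !IH.
Qed.

(* For the largest j with N j > 0 the vacancy number is -1, and
   binom(N j - 1, N j) = 0. *)
Lemma Kterm_vanish L g (n : nat) (N : fseq) : (0 < n < L)%N -> fsize N = n ->
  (forall j, (0 < j < L)%N -> g j = (2 * n)%N%:Z - 1) -> Kterm L g N = 0.
Proof.
move=> /andP[n0 nL] Nn gE.
have NL : (fsize N < L)%N by rewrite Nn.
have ex : exists j, N j != 0%N.
  apply: contraPP n0 => /forallNP N0; rewrite -Nn /fsize big1_seq // => j _.
  by move: (N0 j) => /negP/negbNE/eqP ->; rewrite muln0.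
have ub j : N j != 0%N -> (j <= n)%N.
  by apply: contraR; rewrite -ltnNge -Nn => /fsize_gt ->.
case: (ex_maxnP ex ub) => j Nj jmax.
have jL : (j < L)%N by apply: leq_ltn_trans (ub _ Nj) nL.
have j0 : (0 < j)%N by rewrite lt0n; apply: contraNneq Nj => ->; rewrite fseq0.
rewrite /Kterm (bigD1 (Ordinal jL)) //=.
have -> : vac L g N j = - 1.
  rewrite /vac gE ?j0 //.
  have -> : (\sum_(k < L) minn j k * N k = n)%N.
    rewrite -Nn (fsizeE NL); apply: eq_bigr => k _.
    have [->|Nk] := eqVneq (N k) 0%N; first by rewrite !muln0.
    by rewrite (minn_idPr (jmax _ Nk)).
  by lia.
have -> : -1 + (N j)%:Z = (N j).-1 by move: Nj; rewrite -lt0n; lia.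
by rewrite gbinom_nat ?mul0r // prednK ?lt0n.
Qed.

(** Both sides obey Pascal's rule in c, so their difference E satisfies E(c + 1, n) = E(c, n) + E(c,
    n - 1). By induction on n it does not depend on c, and one value of c where it vanishes
    suffices. *)
Lemma level_sum_Kterm_mu1 L (c : nat) (n : int) : n < L%:Z ->
  level_sum (Kterm L) (fun j => c%:Z * mu 1 j) n = gbinom c n - gbinom c (n - 1).
Proof.
case: n => n nL; last by rewrite level_sum_neg // !gbinom_ltz0 ?subrr //; lia.
have L0 : (0 < L)%N by move: nL; case: (L).
pose A (c : nat) n := level_sum (Kterm L) (fun j => c%:Z * mu 1 j) n.
pose E (c : nat) n := A c n - (gbinom c n - gbinom c (n - 1)).
have AS (c' : nat) k : k < L%:Z -> A c'.+1 k = A c' k + A c' (k - 1).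
  move=> kL; rewrite /A -(Qsys_mu1 L0 (level_sum_ext (Kterm_Qterm L))) //.
    by apply: (level_sum_ext (Kterm_Qterm L)) => j _ /=; rewrite -addn1 PoszD mulrDl mul1r.
  by move=> *; apply: (level_sum_Qsys (Kterm_Qterm L)).
have ES (c' : nat) k : k < L%:Z -> E c'.+1 k = E c' k + E c' (k - 1).
  move=> kL; rewrite /E AS // (gbinomB1 c'.+1 k) (gbinomB1 c'.+1 (k - 1)).
  have -> : c'.+1%:Z - 1 = c' by lia.
  by ring.
suff : E c n = 0 by move/eqP; rewrite subr_eq0 => /eqP.
elim/ltn_ind: n c nL => n IH c nL.
(* The increment E(c', n - 1) vanishes by the induction hypothesis. *)
have Econst (c' : nat) : E c' n = E 0%N n.
  elim: c' => // c' <-; rewrite ES // -[RHS]addr0; congr (_ + _).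
  case: n IH nL {c} => [|n] IH nL.
    by rewrite /E /A level_sum_neg // !gbinom_ltz0 // !subrr.
  have -> : n.+1%:Z - 1 = n by lia.
  by apply: IH => //; lia.
rewrite Econst; case: n IH nL Econst => [|n] IH nL Econst.
  rewrite /E /A level_sum0 gbinom0 gbinom_ltz0 // subr0 /Kterm big1 ?subrr //.
  by move=> m _; rewrite gbinom0.
(* The level is now n + 1 and c = 2(n + 1) - 1: every summand vanishes by [Kterm_vanish], and
   binom(2n + 1, n + 1) = binom(2n + 1, n). *)
rewrite -(Econst (2 * n).+1) /E /A /level_sum fsbig1; last first.
  move=> N /= Nn; apply: (@Kterm_vanish _ _ n.+1); first by move: nL; lia.
    by move: Nn; rewrite /of_fsize /=; lia.
  by move=> j /andP[j0 jL]; rewrite /mu (minn_idPr j0); lia.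
have -> : n.+1%:Z - 1 = n by lia.
rewrite !gbinom_binomial -(@bin_sub _ n); last by lia.
by have -> : ((2 * n).+1 - n = n.+1)%N; [lia|rewrite subrr subr0].
Qed.

Lemma level_sum_Kterm0 L n : n < L%:Z ->
  level_sum (Kterm L) (fun=> 0) n = (n == 0)%:R - (n == 1)%:R.
Proof.
move=> nL; have := level_sum_Kterm_mu1 0 nL.
rewrite (level_sum_ext (Kterm_Qterm L) (h := fun=> 0)) => [->|j _]; last by rewrite mul0r.
have b0 m : gbinom 0 m = (m == 0)%:R.
  by case: m => [[|m]|m]; rewrite ?gbinom0 ?gbinom_nat ?gbinom_ltz0.
by rewrite !b0 subr_eq0.
Qed.

(** * Multiplicities *)

(** The multiplicity of the weight n in the tensor product of the W_s, s in l; the weights of W_s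
    are s - 2 i with 0 <= i <= s. *)
Fixpoint tensor_mult (l : seq nat) (n : int) : nat :=
  if l is s :: l' then (\sum_(i < s.+1) tensor_mult l' (n - s%:Z + 2 * i%:Z))%N
  else (n == 0).

Lemma tensor_multN l n : tensor_mult l (- n) = tensor_mult l n.
Proof.
elim: l n => [|s l IH] n /=; first by rewrite oppr_eq0.
rewrite (reindex_inj rev_ord_inj) /=; apply: eq_bigr => i _.
rewrite -IH; congr (tensor_mult _ _); have := ltn_ord i; lia.
Qed.

Lemma tensor_mult_parity l n : tensor_mult l n != 0%N ->
  exists k : int, n = (sumn l)%:Z - 2 * k.
Proof.
elim: l n => [|s l IH] n /=; first by have [->|n0] := eqVneq n 0; [exists 0|].
rewrite sum_nat_eq0 => /forallPn[i /= /IH[k nk]].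
by exists (k + i%:Z); lia.
Qed.

Definition minsum (l : seq nat) (j : nat) : int := (\sum_(s <- l) minn j s)%N%:Z.

Section Multiplicity.
Variables (L : nat) (t : (nat -> int) -> (nat -> nat) -> rat).
Hypotheses (L_gt0 : (0 < L)%N) (tQ : Qterm L t).

Lemma level_sum_minsum l n : n < L%:Z ->
  level_sum t (minsum l) n =
  if l is s :: l' then \sum_(i < s.+1) level_sum t (minsum l') (n - i%:Z)
  else level_sum t (fun=> 0) n.
Proof.
case: l => [|s l] nL.
  by apply: (level_sum_ext tQ) => j _; rewrite /minsum big_nil.
rewrite -(level_sum_mu tQ) //; apply: (level_sum_ext tQ) => j _.
by rewrite /= /minsum big_cons addnC PoszD.
Qed.

End Multiplicity.

(** Size n corresponds to weight [sumn l] - 2 n; with this substitution [level_sum_minsum] becomes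
    the recursion of [tensor_mult]. *)
Lemma level_sum_Rterm L l n : (0 < L)%N -> n < L%:Z ->
  level_sum (Rterm L) (minsum l) n = (tensor_mult l ((sumn l)%:Z - 2 * n))%:R.
Proof.
move=> L0; elim: l n => [|s l IH] n nL; rewrite (level_sum_minsum L0 (Rterm_Qterm L)) //=.
  rewrite level_sum_Rterm0 //; congr (_%:R); lia.
rewrite natr_sum; apply: eq_bigr => i _; rewrite IH; last by lia.
by congr (tensor_mult _ _)%:R; lia.
Qed.

(** The recursion is the one for R; the initial series 1 - z instead of 1 yields the difference of
    two neighbouring weights. *)
Lemma level_sum_Kterm L l n : (0 < L)%N -> n < L%:Z ->
  level_sum (Kterm L) (minsum l) n =
  (tensor_mult l ((sumn l)%:Z - 2 * n))%:R - (tensor_mult l ((sumn l)%:Z - 2 * n + 2))%:R.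
Proof.
move=> L0; elim: l n => [|s l IH] n nL; rewrite (level_sum_minsum L0 (Kterm_Qterm L)) //=.
  rewrite level_sum_Kterm0 //; congr (_%:R - _%:R); lia.
rewrite !natr_sum -sumrB; apply: eq_bigr => i _; rewrite IH; last by lia.
by congr ((tensor_mult _ _)%:R - (tensor_mult _ _)%:R); lia.
Qed.

(** * The coefficients of R(nu) and K(nu) *)

Definition fseq_list (nu : fseq) : seq nat :=
  flatten [seq nseq (nu s) s | s <- fsupp nu].

Lemma sum_fseq_list nu (F : nat -> nat) :
  (\sum_(s <- fseq_list nu) F s = \sum_(s <- fsupp nu) F s * nu s)%N.
Proof.
rewrite big_flatten /= big_map; apply: eq_bigr => s _.
by rewrite big_nseq iter_addn_0.
Qed.

Lemma PnumE nu (N : fseq) L m : (fsize N < L)%N ->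
  Pnum nu N m = vac L (minsum (fseq_list nu)) N m.
Proof.
move=> NL; rewrite /Pnum /vac /minsum sum_fseq_list; congr (_ - 2 * _%:Z).
apply: (@big_fsupp _ _ _ N) => j; last by move=> ->; rewrite muln0.
by move=> Lj; apply: fsize_gt; apply: leq_trans NL Lj.
Qed.

Lemma Rnum_Rterm nu (N : fseq) L : (fsize N < L)%N ->
  Rnum nu N = Rterm L (minsum (fseq_list nu)) N.
Proof.
move=> NL; rewrite (Rterm_fsupp _ NL) /= /Rnum.
case: (fsupp N) => [|j J]; first by rewrite det_mx00 big_nil mulr1.
congr (_%:~R * _); last by apply: eq_bigr => m _; rewrite (PnumE _ _ NL).
by congr (\det _); apply/matrixP => a b; rewrite !mxE /Fmat (PnumE _ _ NL).
Qed.

Lemma Knum_Kterm nu (N : fseq) L : (fsize N < L)%N ->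
  Knum nu N = Kterm L (minsum (fseq_list nu)) N.
Proof.
move=> NL; rewrite /Knum (@big_fsupp _ _ _ N L); last first.
- by move=> j ->; rewrite addr0 gbinom0.
- by move=> j Lj; apply: fsize_gt; apply: leq_trans NL Lj.
by apply: eq_bigr => m _; rewrite (PnumE _ _ NL).
Qed.

Lemma expoE nu (N : fseq) :
  expo nu N = (sumn (fseq_list nu))%:Z - 2 * (fsize N)%:Z.
Proof. by rewrite /expo sumnE sum_fseq_list. Qed.

Lemma at_weight_even nu n :
  at_weight nu ((sumn (fseq_list nu))%:Z - 2 * n) = of_fsize n.
Proof.
by apply/seteqP; split=> N /=; rewrite /at_weight /of_fsize /= expoE; lia.
Qed.

Lemma at_weight_odd nu n : (forall k, n <> (sumn (fseq_list nu))%:Z - 2 * k) ->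
  at_weight nu n = set0.
Proof.
by move=> no; apply/seteqP; split=> N //; rewrite /at_weight /= expoE => /esym /no.
Qed.

(** The summand comes as a family indexed by the cut-off, since the cut-off must exceed the size;
    |k| + 1 does for size k. *)
Lemma sum_at_weight nu (c : fseq -> rat)
  (t : nat -> (nat -> int) -> (nat -> nat) -> rat) k :
  (forall (N : fseq) L, (fsize N < L)%N -> c N = t L (minsum (fseq_list nu)) N) ->
  \sum_(N \in at_weight nu ((sumn (fseq_list nu))%:Z - 2 * k)) c N
  = level_sum (t `|k|%N.+1) (minsum (fseq_list nu)) k.
Proof.
move=> ct; rewrite at_weight_even; apply: eq_fsbigr => N.
by rewrite inE => Nk; apply: ct; rewrite -Nk absz_nat.
Qed.

Lemma sum_Rnum nu n :
  \sum_(N \in at_weight nu n) Rnum nu N = (tensor_mult (fseq_list nu) n)%:R.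
Proof.
have [[k ->]|no] := pselect (exists k, n = (sumn (fseq_list nu))%:Z - 2 * k).
  rewrite (sum_at_weight _ (@Rnum_Rterm nu)) level_sum_Rterm //; lia.
(* No N has a weight of the wrong parity, and neither has a vector of the tensor product. *)
rewrite at_weight_odd; last by move=> k nk; apply: no; exists k.
have [->|] := eqVneq (tensor_mult (fseq_list nu) n) 0%N; first by rewrite fsbig_set0.
by move=> /tensor_mult_parity.
Qed.

Lemma sum_Knum nu n :
  \sum_(N \in at_weight nu n) Knum nu N =
  (tensor_mult (fseq_list nu) n)%:R - (tensor_mult (fseq_list nu) (n + 2))%:R.
Proof.
have [[k ->]|no] := pselect (exists k, n = (sumn (fseq_list nu))%:Z - 2 * k).
  rewrite (sum_at_weight _ (@Knum_Kterm nu)) level_sum_Kterm //; lia.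
rewrite at_weight_odd; last by move=> k nk; apply: no; exists k.
have [->|/tensor_mult_parity//] := eqVneq (tensor_mult (fseq_list nu) n) 0%N.
have [->|/tensor_mult_parity[k nk]] := eqVneq (tensor_mult (fseq_list nu) (n + 2)) 0%N.
  by rewrite fsbig_set0 subrr.
by exfalso; apply: no; exists (k + 1); lia.
Qed.

Lemma sum_fseqE c (e : fseq -> int) n :
  sum_fseq c e n = \sum_(N \in [set N | e N = n]%classic) c N.
Proof.
rewrite fsbig_mkcond; apply: eq_fsbigr => N _; rewrite /xpow /patch.
have [eN|eN] := eqVneq n (e N); rewrite ?mulr1 ?mulr0.
  by rewrite ifT // inE.
by rewrite ifF //; apply/negP; rewrite inE /= => nN; rewrite nN eqxx in eN.
Qed.

Lemma RseriesE nu n : Rseries nu n = (tensor_mult (fseq_list nu) n)%:R.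
Proof. by rewrite /Rseries sum_fseqE sum_Rnum. Qed.

Lemma KseriesE nu n : Kseries nu n =
  (tensor_mult (fseq_list nu) n)%:R - (tensor_mult (fseq_list nu) (n + 2))%:R.
Proof. by rewrite /Kseries sum_fseqE sum_Knum. Qed.

Lemma smul_xpow k f n : smul (xpow k) f n = f (n - k).
Proof.
rewrite /smul (fsbigTE [fset k]%fset) => [|i].
  by rewrite big_seq_fset1 /xpow eqxx mul1r.
by rewrite inE /xpow => /negbTE ->; rewrite mul0r.
Qed.

Lemma smul_xpowB k m f n : smul (xpow k \- xpow m) f n = f (n - k) - f (n - m).
Proof.
rewrite -!smul_xpow /smul /xpow.
pose A := [fset k; m]%fset.
have out i : i \notin A -> (i == k) = false /\ (i == m) = false.
  by rewrite !inE negb_or => /andP[/negbTE -> /negbTE ->].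
rewrite !(@fsbigTE _ _ _ _ A); first last.
- by move=> i /out[ik im]; rewrite /= ik im subrr mul0r.
- by move=> i /out[ik im]; rewrite ?ik ?im mul0r.
- by move=> i /out[ik im]; rewrite ?ik ?im mul0r.
by rewrite -sumrB; apply: eq_bigr => i _; rewrite mulrBl.
Qed.

(** * Representations of the quantum group of sl(2) *)

Section QuantumSl2.
Variables (F : fieldType) (q : F).
Hypothesis q_neq0 : q != 0.
Hypothesis q_generic : forall n : nat, (0 < n)%N -> q ^+ n != 1.

Lemma q_exp_eq1 (n : int) : (q ^ n == 1) = (n == 0).
Proof.
have pos (m : nat) : (q ^+ m == 1) = (m == 0%N).
  by case: m => [|m]; [rewrite expr0 eqxx|apply/negbTE/q_generic].
case: n => n; first by rewrite -exprnP pos.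
by rewrite NegzE -exprnN invr_eq1 pos oppr_eq0.
Qed.

Lemma q_exp_inj : injective (fun n : int => q ^ n).
Proof.
move=> a b ab; apply/eqP; rewrite -subr_eq0 -q_exp_eq1 expfzDr // ab.
by rewrite -expfzDr // subrr.
Qed.

Definition qint (n : int) : F := (q ^ n - q ^ (- n)) / (q - q^-1).

Lemma q_subV_neq0 : q - q^-1 != 0.
Proof.
rewrite subr_eq0; apply/eqP => qq.
have : q ^+ 2 == 1 by rewrite expr2 {2}qq divff.
by apply/negP/q_generic.
Qed.

Lemma qint_neq0 n : n != 0 -> qint n != 0.
Proof.
move=> n0; rewrite mulf_neq0 ?invr_eq0 ?q_subV_neq0 // subr_eq0.
apply: contra n0 => /eqP/q_exp_inj nn; apply/eqP; lia.
Qed.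

(** The step in the computation of E X^(j+1) on a singular vector. With q^j and q^n as nonzero
    unknowns it is an identity of rational functions. *)
Lemma qint_rec (n j : int) :
  qint j * qint (n - j + 1) + qint (n - 2 * j) = qint (j + 1) * qint (n - j).
Proof.
rewrite /qint.
have -> : n - 2 * j = n + - j + - j by ring.
have -> : - (n + - j + - j) = - n + j + j by ring.
have -> : - (n - j + 1) = - n + j + - 1 by ring.
have -> : - (n - j) = - n + j by ring.
have -> : - (j + 1) = - j + - 1 by ring.
rewrite !expfzDr // -!invr_expz expr1z.
set a := q ^ j; set b := q ^ n.
have a0 : a != 0 by rewrite expfz_neq0.
have b0 : b != 0 by rewrite expfz_neq0.
field; rewrite a0 b0 q_neq0 /=.
by rewrite andbT subr_eq0 -expr2 q_generic.
Qed.

(** * Weight vectors and singular vectors *)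

Definition act d (X : 'M[F]_d) (j : nat) (u : 'rV[F]_d) : 'rV[F]_d :=
  iter j (mulmxr X) u.

Lemma actS d (X : 'M[F]_d) j u : act X j.+1 u = act X j u *m X.
Proof. by []. Qed.

Lemma actSr d (X : 'M[F]_d) j u : act X j.+1 u = act X j (u *m X).
Proof. exact: iterSr. Qed.

Lemma actZ d (X : 'M[F]_d) j a u : act X j (a *: u) = a *: act X j u.
Proof. by elim: j => // j IH; rewrite !actS IH scalemxAl. Qed.

Lemma act0 d (X : 'M[F]_d) j : act X j 0 = 0.
Proof. by elim: j => // j IH; rewrite actS IH mul0mx. Qed.

Lemma act_eq0S d (X : 'M[F]_d) u i j : act X i u = 0 -> (i <= j)%N -> act X j u = 0.
Proof. by move=> u0 /subnK <-; rewrite /act iterD -/(act X i u) u0; exact: act0. Qed.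

(* A U_q(sl2)-module acting on row vectors from the right; the relations are the
   transposes of those for a left action. *)
Record rmodule d (E X K : 'M[F]_d) : Prop := RModule {
  rm_unit : K \in unitmx;
  rm_EK : E *m K = q ^ 2 *: (K *m E);
  rm_XK : X *m K = q ^ (- 2) *: (K *m X);
  rm_XE : X *m E - E *m X = (q - q^-1)^-1 *: (K - invmx K) }.

Lemma mulmx_invmx_comm d (A K : 'M[F]_d) n : K \in unitmx ->
  A *m K = q ^ n *: (K *m A) -> A *m invmx K = q ^ (- n) *: (invmx K *m A).
Proof.
move=> Ku AK; apply: (can_inj (mulmxK Ku)); rewrite mulmxKV //.
rewrite -scalemxAl -mulmxA AK -scalemxAr mulmxA mulVmx // mul1mx scalerA.
by rewrite -expfzDr // addNr expr0z scale1r.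
Qed.

(** The involution exchanging e and f and inverting k; it turns each statement on highest weights
    into one on lowest weights. *)
Lemma rmodule_swap d (E X K : 'M[F]_d) :
  rmodule E X K -> rmodule X E (invmx K).
Proof.
case=> Ku EK XK XE; split.
- by rewrite unitmx_inv.
- exact: (@mulmx_invmx_comm _ _ _ (- 2)).
- exact: (@mulmx_invmx_comm _ _ _ 2).
- by rewrite invmxK -opprB XE -scalerN opprB.
Qed.

Section Triple.
Variables (d : nat) (E X K : 'M[F]_d).
Hypothesis EXK : rmodule E X K.

Definition wt (n : int) (u : 'rV[F]_d) := u *m K = q ^ n *: u.

Lemma wtE n u : wt n u -> wt (n + 2) (u *m E).
Proof.
case: EXK => _ EK _ _ un; rewrite /wt -mulmxA EK -scalemxAr mulmxA un -scalemxAl.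
by rewrite scalerA -expfzDr // addrC.
Qed.

Lemma wtX n u : wt n u -> wt (n - 2) (u *m X).
Proof.
case: EXK => _ _ XK _ un; rewrite /wt -mulmxA XK -scalemxAr mulmxA un -scalemxAl.
by rewrite scalerA -expfzDr // addrC.
Qed.

Lemma wt_actE n u j : wt n u -> wt (n + 2 * j%:Z) (act E j u).
Proof.
move=> un; elim: j => [|j IH]; first by rewrite mulr0 addr0.
have -> : n + 2 * j.+1%:Z = n + 2 * j%:Z + 2 by lia.
by rewrite actS; apply: wtE.
Qed.

Lemma wt_actX n u j : wt n u -> wt (n - 2 * j%:Z) (act X j u).
Proof.
move=> un; elim: j => [|j IH]; first by rewrite mulr0 subr0.
have -> : n - 2 * j.+1%:Z = n - 2 * j%:Z - 2 by lia.
by rewrite actS; apply: wtX.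
Qed.

Lemma wtV n u : wt n u -> u *m invmx K = q ^ (- n) *: u.
Proof.
move=> un; apply: (can_inj (mulmxK (rm_unit EXK))).
rewrite mulmxKV ?(rm_unit EXK) // -scalemxAl un scalerA -expfzDr // addNr.
by rewrite expr0z scale1r.
Qed.

Lemma wtXE n u : wt n u -> u *m X *m E = u *m E *m X + qint n *: u.
Proof.
move=> un; apply/eqP; rewrite addrC -subr_eq -!mulmxA -mulmxBr (rm_XE EXK).
by rewrite -scalemxAr mulmxBr un (wtV un) -scalerBl scalerA /qint mulrC.
Qed.

(* The weights of the vectors u E^j give pairwise distinct eigenvalues of K. *)
Lemma actE_eventually0 n u : wt n u -> exists j, act E j u = 0.
Proof.
move=> un; apply: contrapT => /forallNP ne.
have rt j : root (char_poly K) (q ^ (n + 2 * j%:Z)).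
  rewrite -eigenvalue_root_char; apply/eigenvalueP; exists (act E j u).
    exact: wt_actE.
  exact/eqP/ne.
have := @max_poly_roots _ (char_poly K) [seq q ^ (n + 2 * j%:Z) | j <- iota 0 d.+1].
rewrite size_map size_iota size_char_poly ltnn => H; suff : false by [].
apply: H.
- exact/monic_neq0/char_poly_monic.
- by apply/allP => _ /mapP[j _ ->].
- by rewrite map_inj_uniq ?iota_uniq // => i j /q_exp_inj; lia.
Qed.

Lemma actE_last n u : wt n u -> u != 0 ->
  exists j, act E j u != 0 /\ act E j.+1 u = 0.
Proof.
move=> un u0; have [j0 /eqP ej0] := actE_eventually0 un.
have ex : exists j, act E j u == 0 by exists j0.
case: (ex_minnP ex) => [[|j]] /eqP uj jmin; first by rewrite [u]uj eqxx in u0.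
by exists j; split=> //; apply/negP => /jmin; rewrite ltnn.
Qed.

(** Moving E past the last X adds [n - 2(j + 1)] to the coefficient, and [qint_rec] evaluates the
    sum. *)
Lemma singular_actX n v j : wt n v -> v *m E = 0 ->
  act X j.+1 v *m E = (qint (j%:Z + 1) * qint (n - j%:Z)) *: act X j v.
Proof.
move=> vn vE; elim: j => [|j IH].
  rewrite /= (wtXE vn) vE mul0mx add0r subr0 add0r.
  by rewrite /qint expr1z exprN1 divff ?q_subV_neq0 // mul1r.
rewrite actS (wtXE (wt_actX j.+1 vn)) IH -scalemxAl -actS -scalerDl.
congr (_ *: _); have := qint_rec n j.+1.
have -> : n - j.+1%:Z + 1 = n - j%:Z by lia.
have -> : j.+1%:Z = j%:Z + 1 by lia.
by [].
Qed.

Lemma qintN n : qint (- n) = - qint n.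
Proof. by rewrite /qint opprK -mulNr opprB. Qed.

(* If x X E = 0 then E X acts on x E^j by [j+1][-n-j], which is nonzero for
   n > 0; this contradicts x E^j <> 0 = x E^(j+1). *)
Lemma wt_XE_inj n x : 0 < n -> wt n x -> x *m X *m E = 0 -> x = 0.
Proof.
move=> n0 xn xXE.
have EX j : act E j x *m E *m X = (qint (j%:Z + 1) * qint (- n - j%:Z)) *: act E j x.
  elim: j => [|j IH].
    rewrite /= add0r subr0 qintN /qint expr1z exprN1 divff ?q_subV_neq0 // mul1r.
    by rewrite scaleNr -/(qint n); apply/eqP; rewrite -addr_eq0 -(wtXE xn) xXE.
  apply/eqP; rewrite -(inj_eq (addIr (qint (n + 2 * j.+1%:Z) *: act E j.+1 x))).
  rewrite -(wtXE (wt_actE j.+1 xn)) {1}actS IH -scalemxAl -actS -scalerDl.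
  apply/eqP; congr (_ *: _).
  have := qint_rec (- n) j.+1.
  have -> : - n - j.+1%:Z + 1 = - n - j%:Z by lia.
  have -> : - n - 2 * j.+1%:Z = - (n + 2 * j.+1%:Z) by lia.
  rewrite qintN (_ : j%:Z + 1 = j.+1); last by lia.
  by move=> <-; rewrite subrK.
apply/eqP; apply: contraT => x0; have [j [xj xj1]] := actE_last xn x0.
have /esym/eqP := EX j; rewrite -actS xj1 mul0mx scaler_eq0 (negbTE xj) orbF.
by rewrite mulf_eq0 !(negbTE (qint_neq0 _)) //; lia.
Qed.

End Triple.

(** If X^j v is the last nonzero vector of the string, then [j + 1][n - j] = 0 by [singular_actX],
    which forces n = j. *)
Lemma singular_weight d (E X K : 'M[F]_d) n v : rmodule E X K ->
  wt K n v -> v *m E = 0 -> v != 0 -> exists m : nat, n = m /\ act X m.+1 v = 0.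
Proof.
move=> EXK vn vE v0.
have [j [vj vj1]] := actE_last (rmodule_swap EXK) (wtV EXK vn) v0.
exists j; split => //; have /esym/eqP := singular_actX EXK j vn vE.
rewrite vj1 mul0mx scaler_eq0 (negbTE vj) orbF mulf_eq0.
rewrite (negbTE (qint_neq0 _)) /=; last by lia.
have [/eqP|nj] := eqVneq (n - j%:Z) 0; first by rewrite subr_eq0 => /eqP.
by rewrite (negbTE (qint_neq0 nj)).
Qed.

Lemma wt_EX_inj d (E X K : 'M[F]_d) n x : rmodule E X K ->
  n < 0 -> wt K n x -> x *m E *m X = 0 -> x = 0.
Proof.
move=> EXK n0 xn; apply: (wt_XE_inj (rmodule_swap EXK) (n := - n)).
  by rewrite oppr_gt0.
exact: (wtV EXK xn).
Qed.

Lemma actD d (Y : 'M[F]_d) j u v : act Y j (u + v) = act Y j u + act Y j v.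
Proof. by elim: j => // j IH; rewrite !actS IH mulmxDl. Qed.

Lemma act_sum d (Y : 'M[F]_d) j (I : finType) (P : pred I) (f : I -> 'rV_d) :
  act Y j (\sum_(i | P i) f i) = \sum_(i | P i) act Y j (f i).
Proof. by apply: big_morph; [move=> *; exact: actD|exact: act0]. Qed.

(** * The string v, v X, v X^2, ... of a singular vector *)

Definition strmx d (X : 'M[F]_d) p (v : 'rV[F]_d) : 'M[F]_(p, d) :=
  \matrix_(i < p) act X i v.

(** The generators on a string. These matrices depend only on p and n, so strings in different
    modules can be compared. *)
Definition string_X p : 'M[F]_p := \matrix_(i, j) (j == i.+1 :> nat)%:R.
Definition string_E p (n : int) : 'M[F]_p :=
  \matrix_(i, j) (if i == j.+1 :> nat then qint (j%:Z + 1) * qint (n - j%:Z) else 0).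
Definition string_K p (n : int) : 'M[F]_p :=
  diag_mx (\row_i q ^ (n - 2 * (i : nat)%:Z)).

Section Strings.
Variables (d : nat) (E X K : 'M[F]_d) (n : int) (v : 'rV[F]_d).
Hypotheses (EXK : rmodule E X K) (vn : wt K n v) (vE : v *m E = 0).

Lemma row_strmx p (i : 'I_p) : row i (strmx X p v) = act X i v.
Proof. by rewrite rowK. Qed.

Lemma strmx_X p : act X p v = 0 -> strmx X p v *m X = string_X p *m strmx X p v.
Proof.
move=> vp; apply/row_matrixP => i; rewrite !row_mul row_strmx [RHS]mulmx_sum_row -actS.
have [ip|ip] := ltnP i.+1 p; last first.
  have -> : i.+1 = p by apply/eqP; rewrite eqn_leq ip ltn_ord.
  rewrite vp big1 // => j _; rewrite !mxE ltn_eqF ?scale0r //.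
  exact: leq_trans (ltn_ord j) ip.
rewrite (bigD1 (Ordinal ip)) //= big1 ?addr0; first by rewrite !mxE eqxx scale1r row_strmx.
move=> j ji; rewrite !mxE (_ : (j == i.+1 :> nat) = false) ?scale0r //.
exact/negbTE.
Qed.

Lemma strmx_E p : strmx X p v *m E = string_E p n *m strmx X p v.
Proof.
apply/row_matrixP => i; rewrite !row_mul row_strmx [RHS]mulmx_sum_row.
case i0 : (nat_of_ord i) => [|k].
  by rewrite vE big1 // => j _; rewrite !mxE i0 scale0r.
have kp : (k < p)%N by rewrite ltnW // -i0.
rewrite (singular_actX EXK _ vn) // (bigD1 (Ordinal kp)) //= big1 ?addr0.
  by rewrite !mxE i0 eqxx row_strmx.
move=> j jk; rewrite !mxE i0 eqSS eq_sym (_ : (j == k :> nat) = false) ?scale0r //.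
exact/negbTE.
Qed.

Lemma strmx_K p : strmx X p v *m K = string_K p n *m strmx X p v.
Proof.
apply/row_matrixP => i; rewrite !row_mul row_strmx row_diag_mx -scalemxAl.
by rewrite -rowE row_strmx !mxE (wt_actX EXK i vn).
Qed.

Lemma actE_actX0 i j : (i < j)%N -> act E j (act X i v) = 0.
Proof.
move=> ij; suff e : act E i.+1 (act X i v) = 0 by apply: act_eq0S e ij.
elim: i {j ij} => [|i IH]; first exact: vE.
by rewrite actSr (singular_actX EXK _ vn) // actZ IH scaler0.
Qed.

Lemma actE_actX (j : nat) : (j%:Z <= n) ->
  exists2 a, a != 0 & act E j (act X j v) = a *: v.
Proof.
elim: j => [|j IH] jn; first by exists 1; rewrite ?oner_eq0 ?scale1r.
have [|a a0 ea] := IH; first by lia.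
rewrite actSr (singular_actX EXK _ vn) // actZ ea scalerA.
eexists; last by reflexivity.
by apply: mulf_neq0 => //; apply: mulf_neq0; apply: qint_neq0; lia.
Qed.

(** Let j be the largest index with a nonzero coefficient. Then E^j kills the lower terms and sends
    X^j v to a nonzero multiple of v, as j <= n. *)
Lemma string_top p (c : 'rV[F]_p) : p%:Z <= n + 1 -> c != 0 ->
  exists j, exists2 a, a != 0 & act E j (c *m strmx X p v) = a *: v.
Proof.
move=> pn c0.
have [i0 ci0] : exists i, c 0 i != 0 by apply/rV0Pn.
case: (@arg_maxnP _ i0 (fun i => c 0 i != 0) val ci0) => j cj jmax.
exists j; have [|a a0 ea] := @actE_actX j; first by have := ltn_ord j; lia.
exists (c 0 j * a); first exact: mulf_neq0.
rewrite mulmx_sum_row act_sum (bigD1 j) //= big1 ?addr0.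
  by rewrite actZ row_strmx ea scalerA.
move=> i ij; rewrite actZ row_strmx.
have [->|ci] := eqVneq (c 0 i) 0; first by rewrite scale0r.
rewrite actE_actX0 ?scaler0 // ltn_neqAle; apply/andP; split; last exact: jmax.
by apply: contra ij => /eqP/val_inj ->.
Qed.

Lemma strmx_free p : p%:Z <= n + 1 -> v != 0 -> row_free (strmx X p v).
Proof.
move=> pn v0; rewrite -kermx_eq0; apply/rowV0P => c /sub_kermxP cs.
apply/eqP; apply: contraT => c0; have [j [a a0]] := string_top pn c0.
rewrite cs act0 => /esym/eqP.
by rewrite scaler_eq0 (negbTE a0) (negbTE v0).
Qed.

End Strings.

(** * Simple modules and their singular vectors *)

Local Notation mE M := (qe M 0)^T.
Local Notation mX M := (qf M 0)^T.
Local Notation mK M := (qk M 0)^T.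
Local Notation qrmodule M := (rmodule (mE M) (mX M) (mK M)).

Lemma is_qmodule_rmodule (M : qmod F 1) : is_qmodule q cartan_sl2 M -> qrmodule M.
Proof.
case=> Ku _ Ke Kf ef _ _; split; rewrite ?unitmx_tr //.
- by rewrite -!trmx_mul Ke mxE linearZ.
- by rewrite -!trmx_mul Kf mxE linearZ.
- by rewrite -!trmx_mul -[LHS]linearB /= ef eqxx linearZ /= raddfB /= trmx_inv.
Qed.

Lemma rmodule_is_qmodule (M : qmod F 1) : qrmodule M -> is_qmodule q cartan_sl2 M.
Proof.
case; rewrite unitmx_tr => Ku EK XK XE; split=> i; rewrite ?(ord1 i) //;
  move=> j; rewrite ?(ord1 j) // ?mxE; apply: trmx_inj.
- by rewrite linearZ /= !trmx_mul EK.
- by rewrite linearZ /= !trmx_mul XK.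
- by rewrite raddfB linearZ /= !trmx_mul XE [in RHS]raddfB /= trmx_inv.
Qed.

Definition rhom (M N : qmod F 1) (f : 'M[F]_(qdim M, qdim N)) : Prop :=
  [/\ mE M *m f = f *m mE N, mX M *m f = f *m mX N & mK M *m f = f *m mK N].

Lemma qiso_rhom (M N : qmod F 1) :
  qiso M N <-> exists f, [/\ rhom f, row_free f & row_full (f : 'M_(qdim M, qdim N))].
Proof.
split=> [[S [T [ST TS SH]]]|[f [[fE fX fK] ffree ffull]]].
  exists S^T; have [SE SX SK] := SH 0; split.
  - by split; rewrite -!trmx_mul ?SE ?SX ?SK.
  - by apply/row_freeP; exists T^T; rewrite -trmx_mul TS trmx1.
  - by apply/row_fullP; exists T^T; rewrite -trmx_mul ST trmx1.
exists f^T, (pinvmx f)^T; split=> [||i].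
- by rewrite -trmx_mul mulVpmx ?trmx1.
- by rewrite -trmx_mul mulmxVp ?trmx1.
- by rewrite (ord1 i); split; apply: trmx_inj; rewrite !trmx_mul trmxK.
Qed.

Definition sing (M : qmod F 1) (n : int) : 'M[F]_(qdim M) :=
  (eigenspace (mK M) (q ^ n) :&: kermx (mE M))%MS.

Lemma singP (M : qmod F 1) n (u : 'rV[F]_(qdim M)) :
  reflect (wt (mK M) n u /\ u *m mE M = 0) (u <= sing M n)%MS.
Proof.
rewrite sub_capmx; apply: (iffP andP) => [[/eigenspaceP uK /sub_kermxP uE]|[uK uE]] //.
by split; [exact/eigenspaceP|exact/sub_kermxP].
Qed.

Lemma sing_rhom (M N : qmod F 1) n (f : 'M_(qdim M, qdim N)) :
  rhom f -> (sing M n *m f <= sing N n)%MS.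
Proof.
case=> fE _ fK; apply/row_subP => i; rewrite row_mul; set u := row i _.
have /singP[uK uE] : (u <= sing M n)%MS by exact: row_sub.
apply/singP; split; last by rewrite -mulmxA -fE mulmxA uE mul0mx.
by rewrite /wt -mulmxA -fK mulmxA uK scalemxAl.
Qed.

Lemma qiso_sym (M N : qmod F 1) : qiso M N -> qiso N M.
Proof.
case=> [S [T [ST TS SH]]]; exists T, S; split=> // i; have [SE SX SK] := SH i.
have tr A B : S *m A = B *m S -> T *m B = A *m T.
  by move=> AB; rewrite -[T *m B]mulmx1 -ST mulmxA -[T *m B *m S]mulmxA -AB mulmxA TS mul1mx.
by split; apply: tr.
Qed.

Lemma qiso_sing (M N : qmod F 1) n : qiso M N -> \rank (sing M n) = \rank (sing N n).
Proof.
suff le (M' N' : qmod F 1) : qiso M' N' -> (\rank (sing M' n) <= \rank (sing N' n))%N.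
  by move=> MN; apply/eqP; rewrite eqn_leq !le //; exact: qiso_sym.
case/qiso_rhom=> f [fh ff _].
by rewrite -(mxrankMfree (sing M' n) ff) mxrankS ?sing_rhom.
Qed.

(** A model-free description of V_n; [standard_qiso] shows that it determines the module up to
    isomorphism. *)
Definition standard (M : qmod F 1) (n : nat) : Prop :=
  [/\ qrmodule M, qdim M = n.+1 &
      exists v, [/\ v != 0, wt (mK M) n v & v *m mE M = 0]].

Lemma standard_basis (M : qmod F 1) n v : qrmodule M -> qdim M = n.+1 ->
  v != 0 -> wt (mK M) n v -> v *m mE M = 0 ->
  strmx (mX M) (qdim M) v \in unitmx.
Proof.
move=> Mm Md v0 vn vE; rewrite -row_free_unit.
by apply: (strmx_free Mm vn vE) => //; rewrite Md -addn1 PoszD.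
Qed.

(** The string of v is a basis of N and is mapped to the string of u. The generators have the same
    matrices on both, since the weight and the length agree and both strings end at X^(n+1). *)
Lemma standard_rhom (N M : qmod F 1) n (u : 'rV[F]_(qdim M)) :
  standard N n -> qrmodule M -> u != 0 -> wt (mK M) n u -> u *m mE M = 0 ->
  exists f : 'M_(qdim N, qdim M), [/\ rhom f, row_free f & (u <= f)%MS].
Proof.
case=> Nm Nd [v [v0 vn vE]] Mm u0 un uE.
have Pu := standard_basis Nm Nd v0 vn vE; set P := strmx _ _ _ in Pu.
pose Q := strmx (mX M) (qdim N) u.
have Nle : (qdim N)%:Z <= n%:Z + 1 by rewrite Nd -addn1 PoszD.
have vX : act (mX N) (qdim N) v = 0.
  by have [m [[nm] /act_eq0S]] := singular_weight Nm vn vE v0; apply; rewrite Nd nm.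
have uX : act (mX M) (qdim N) u = 0.
  by have [m [[nm] /act_eq0S]] := singular_weight Mm un uE u0; apply; rewrite Nd nm.
have inter A B C : P *m A = C *m P -> Q *m B = C *m Q ->
    A *m (invmx P *m Q) = invmx P *m Q *m B.
  move=> PA QB; rewrite -[RHS]mulmxA QB; apply: (can_inj (mulKmx Pu)).
  by rewrite !mulmxA PA mulmxV // mul1mx -[C *m P *m _]mulmxA mulmxV // mulmx1.
exists (invmx P *m Q); split.
- split.
  + exact: inter (strmx_E Nm vn vE _) (strmx_E Mm un uE _).
  + exact: inter (strmx_X vX) (strmx_X uX).
  + exact: inter (strmx_K Nm vn _) (strmx_K Mm un _).
- rewrite /row_free mxrankMfree ?mxrank_unit ?unitmx_inv //.
  exact: (strmx_free Mm un uE).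
- have d0 : (0 < qdim N)%N by rewrite Nd.
  have -> : u = row (Ordinal d0) Q by rewrite row_strmx.
  rewrite -[Q in row _ Q](mulKVmx Pu) row_mul; exact: submxMl.
Qed.

Lemma standard_qiso (M N : qmod F 1) n : standard M n -> standard N n -> qiso M N.
Proof.
move=> Ms [Nm Nd [v [v0 vn vE]]]; apply/qiso_rhom.
have [f [fh ff _]] := standard_rhom Ms Nm v0 vn vE.
exists f; split => //; rewrite /row_full (eqP ff) Nd.
by case: Ms => _ /eqP.
Qed.

Lemma submx_act d (Y : 'M[F]_d) m (U : 'M[F]_(m, d)) u j :
  (U *m Y <= U)%MS -> (u <= U)%MS -> (act Y j u <= U)%MS.
Proof.
move=> UY uU; elim: j => // j IH; rewrite actS.
exact: submx_trans (submxMr _ IH) UY.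
Qed.

(** By [string_top] a nonzero submodule contains v, hence its whole string. *)
Lemma standard_irreducible (M : qmod F 1) n : standard M n -> irreducible M.
Proof.
case=> Mm Md [v [v0 vn vE]]; split; first by rewrite Md.
move=> U /(_ 0)[UE UX _]; have [->|U0] := eqVneq U 0; first by left; exact: mxrank0.
right; have Pu := standard_basis Mm Md v0 vn vE.
have /rowV0Pn[u uU u0] := U0; pose c := u *m invmx (strmx (mX M) (qdim M) v).
have cu : c *m strmx (mX M) (qdim M) v = u by rewrite mulmxKV.
have c0 : c != 0 by apply: contraNneq u0 => c0; rewrite -cu c0 mul0mx.
have [|j [a a0 ua]] := string_top Mm vn vE _ c0; first by rewrite Md -addn1 PoszD.
have vU : (v <= U)%MS.
  rewrite -(scale1r v) -(mulVf a0) -scalerA -ua cu scalemx_sub //.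
  exact: submx_act UE uU.
apply/eqP; rewrite eqn_leq rank_leq_col -{1}(mxrank_unit Pu) mxrankS //.
by apply/row_subP => i; rewrite row_strmx; exact: submx_act UX vU.
Qed.

(** The string of v spans a nonzero submodule, hence the whole module, and it is free of length m +
    1. *)
Lemma irreducible_standard (M : qmod F 1) n v : qrmodule M -> irreducible M ->
  v != 0 -> wt (mK M) n v -> v *m mE M = 0 -> exists2 m : nat, n = m & standard M m.
Proof.
move=> Mm [_ irr] v0 vn vE; have [m [nm vX]] := singular_weight Mm vn vE v0.
exists m => //; rewrite {}nm in vn; split => //; last by exists v.
have free : row_free (strmx (mX M) m.+1 v).
  by apply: (strmx_free Mm vn vE) => //; rewrite -addn1 PoszD.
(* [genmx] gives the span of the string as a square matrix, the form in which [is_submodule] takes a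
   subspace. *)
have [] := irr <<strmx (mX M) m.+1 v>>%MS.
- move=> i; rewrite (ord1 i) !(eqmxMr _ (genmxE _)) !genmxE.
  by rewrite (strmx_E Mm vn vE) (strmx_X vX) (strmx_K Mm vn) !submxMl.
- by rewrite mxrank_gen (eqP free).
- by rewrite mxrank_gen (eqP free).
Qed.

(** Some E^j sends a nonzero singular vector to a nonzero multiple of v; as E kills it, j = 0. *)
Lemma standard_sing (M : qmod F 1) n : standard M n -> \rank (sing M n) = 1%N.
Proof.
case=> Mm Md [v [v0 vn vE]]; have Pu := standard_basis Mm Md v0 vn vE.
suff : (sing M n == v)%MS by move/eqmxP => ->; rewrite rank_rV v0.
rewrite andbC; apply/andP; split; first exact/singP.
apply/row_subP => i; set u := row i _.
have /singP[un uE] : (u <= sing M n)%MS by exact: row_sub.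
have [->|u0] := eqVneq u 0; first exact: sub0mx.
pose c := u *m invmx (strmx (mX M) (qdim M) v).
have cu : c *m strmx (mX M) (qdim M) v = u by rewrite mulmxKV.
have c0 : c != 0 by apply: contraNneq u0 => c0; rewrite -cu c0 mul0mx.
have [|j [a a0]] := string_top Mm vn vE _ c0; first by rewrite Md -addn1 PoszD.
rewrite cu; case: j => [/= ->|j]; first exact: scalemx_sub.
by rewrite actSr uE act0 => /esym/eqP; rewrite scaler_eq0 (negbTE a0) (negbTE v0).
Qed.

Lemma irreducible_sing0 (V L : qmod F 1) n : standard V n -> qrmodule L ->
  irreducible L -> ~ qiso L V -> sing L n = 0.
Proof.
move=> Vs Lm Lirr LV; apply/eqP; apply: contra_notT LV => /rowV0Pn[v /singP[vn vE] v0].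
have [m [nm] Ls] := irreducible_standard Lm Lirr v0 vn vE.
by rewrite nm in Vs; exact: standard_qiso Ls Vs.
Qed.

Lemma sing_qsum (M N : qmod F 1) n :
  \rank (sing (qsum M N) n) = (\rank (sing M n) + \rank (sing N n))%N.
Proof.
rewrite -rank_diag_block_mx; apply/eqP; rewrite eqn_leq; apply/andP; split; apply: mxrankS.
  apply/row_subP => i; set u := row i _.
  have /singP[] : (u <= sing (qsum M N) n)%MS by exact: row_sub.
  rewrite -[u in wt _ _ u]hsubmxK -[u in u *m _]hsubmxK.
  rewrite /wt /= !tr_block_mx !trmx0 !mul_row_block !mulmx0 !addr0 !add0r.
  rewrite scale_row_mx => /eq_row_mx[lK rK].
  rewrite -row_mx0 => /eq_row_mx[lE rE].
  have /submxP[a la] : (lsubmx u <= sing M n)%MS by exact/singP.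
  have /submxP[b rb] : (rsubmx u <= sing N n)%MS by exact/singP.
  rewrite -[u in (u <= _)%MS]hsubmxK la rb; apply/submxP; exists (row_mx a b).
  by rewrite mul_row_block !mulmx0 addr0 add0r.
rewrite -[block_mx _ _ _ _]/(col_mx _ _) col_mx_sub; apply/andP; split;
  apply/row_subP => i; rewrite row_row_mx row0; apply/singP;
  rewrite /wt /= !tr_block_mx !trmx0 !mul_row_block !mulmx0 !mul0mx !addr0 ?add0r;
  rewrite scale_row_mx scaler0.
  have /singP[-> ->] : (row i (sing M n) <= sing M n)%MS by exact: row_sub.
  by rewrite row_mx0.
have /singP[-> ->] : (row i (sing N n) <= sing N n)%MS by exact: row_sub.
by rewrite row_mx0.
Qed.

Lemma sing_qsum_seq (s : seq (qmod F 1)) n :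
  \rank (sing (qsum_seq s) n) = (\sum_(M <- s) \rank (sing M n))%N.
Proof.
elim: s => [|M s IH]; last by rewrite big_cons -IH -sing_qsum.
by rewrite big_nil; apply/eqP; rewrite -leqn0 rank_leq_col.
Qed.

(** Singular vectors of weight n are additive over direct sums; each copy of V has a line of them
    and the other simple summands have none. This gives the uniqueness of the multiplicity. *)
Lemma decomposes_with_sing (M V : qmod F 1) n m : standard V n ->
  decomposes_with q M V m -> m = \rank (sing M n).
Proof.
move=> Vs [k [L [Lh Miso]]]; rewrite (qiso_sing _ Miso) sing_qsum_seq big_cat /=.
rewrite big_nseq iter_addn_0 (standard_sing Vs) mul1n big_image /= big1 ?addn0 //.
move=> i _; have [Lm Lirr LV] := Lh i.
by rewrite (irreducible_sing0 Vs) ?mxrank0 //; exact: is_qmodule_rmodule.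
Qed.

(** * Weight multiplicities and tensor products *)

Definition has_weights (M : qmod F 1) (D : int -> nat) : Prop :=
  exists (P : 'M[F]_(qdim M)) (a : 'I_(qdim M) -> int),
  [/\ P \in unitmx, P *m mK M = diag_mx (\row_i q ^ a i) *m P
    & forall n, (\sum_i (a i == n) = D n)%N].

(** The eigenspace is spanned by the rows of P of weight n; [R] below selects them. *)
Lemma has_weights_dim (M : qmod F 1) D n : has_weights M D -> weight_dim q M n = D n.
Proof.
case=> P [a [Pu PK aD]]; rewrite /weight_dim -aD.
pose A := [pred i | a i == n].
have -> : (\sum_i (a i == n) = #|A|)%N.
  by rewrite -sum1_card [RHS]big_mkcond; apply: eq_bigr => i _; rewrite inE; case: eqP.
pose f (k : 'I_#|A|) : 'I_(qdim M) := enum_val k.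
pose R := rowsub f 1%:M : 'M[F]_(#|A|, qdim M).
have Rfree : row_free R.
  apply/row_freeP; exists R^T; apply/matrixP => i j; rewrite !mxE.
  rewrite (bigD1 (f i)) //= big1 ?addr0; last first.
    by move=> k ki; rewrite !mxE eq_sym (negbTE ki) mul0r.
  by rewrite !mxE eqxx mul1r eq_sym (inj_eq enum_val_inj).
rewrite -(eqP Rfree) -(mxrankMfree R (B := P)) ?row_free_unit //.
apply/eqP; rewrite eqn_leq; apply/andP; split; apply: mxrankS; last first.
  apply/eigenspaceP; rewrite -mulmxA PK mulmxA scalemxAl; congr (_ *m _).
  rewrite /R mul_rowsub_mx mul1mx; apply/matrixP => i j; rewrite !mxE.
  have := enum_valP i; rewrite inE -/(f i) => /eqP <-.
  by case: eqVneq => [->|_]; rewrite ?mulr1 ?mulr0.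
apply/row_subP => i; set u := row i _.
have /eigenspaceP uK : (u <= eigenspace (mK M) (q ^ n))%MS by exact: row_sub.
have [w wu] : exists w, w *m P = u by exists (u *m invmx P); rewrite mulmxKV.
have wD : w *m diag_mx (\row_i q ^ a i) = q ^ n *: w.
  apply: (can_inj (mulmxK Pu)); rewrite -mulmxA -PK mulmxA wu uK.
  by rewrite -scalemxAl wu.
(* Distinct weights give distinct eigenvalues, as q is not a root of unity. *)
have w0 j : a j != n -> w 0 j = 0.
  move=> jn; have /rowP/(_ j) := wD.
  rewrite mul_mx_diag !mxE mulrC => /eqP; rewrite -subr_eq0 -mulrBl mulf_eq0.
  rewrite subr_eq0 => /orP[/eqP/q_exp_inj /eqP|/eqP //].
  by rewrite (negbTE jn).
rewrite -wu; apply: submxMr; apply/submxP; exists (colsub f w).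
apply/rowP => j; rewrite [RHS]mxE.
have [ja|ja] := boolP (j \in A).
  rewrite (bigD1 (enum_rank_in ja j)) //= big1 ?addr0.
    by rewrite !mxE /f enum_rankK_in // eqxx mulr1.
  move=> k kj; rewrite !mxE (_ : (f k == j) = false) ?mulr0 //; apply/negbTE.
  by apply: contra kj => /eqP kj; apply/eqP/enum_val_inj; rewrite enum_rankK_in.
rewrite big1 ?w0 // => k _; rewrite !mxE (_ : (f k == j) = false) ?mulr0 //.
by apply/negbTE; apply: contraNneq ja => <-; exact: enum_valP.
Qed.

Section TensorLinear.
Variables (m n p r : nat).
Implicit Types (A : 'M[F]_(m, n)) (B : 'M[F]_(p, r)).

Lemma tensmxDl A1 A2 B : (A1 + A2) *t B = A1 *t B + A2 *t B.
Proof. by apply/matrixP => i j; rewrite !mxE mulrDl. Qed.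

Lemma tensmxDr A B1 B2 : A *t (B1 + B2) = A *t B1 + A *t B2.
Proof. by apply/matrixP => i j; rewrite !mxE mulrDr. Qed.

Lemma tensmxZl a A B : (a *: A) *t B = a *: (A *t B).
Proof. by apply/matrixP => i j; rewrite !mxE mulrA. Qed.

Lemma tensmxZr a A B : A *t (a *: B) = a *: (A *t B).
Proof. by apply/matrixP => i j; rewrite !mxE mulrCA. Qed.

Lemma tensmxNl A B : (- A) *t B = - (A *t B).
Proof. by apply/matrixP => i j; rewrite !mxE mulNr. Qed.

Lemma tensmxNr A B : A *t (- B) = - (A *t B).
Proof. by apply/matrixP => i j; rewrite !mxE mulrN. Qed.

End TensorLinear.

Lemma tens1mx m n : 1%:M *t 1%:M = 1%:M :> 'M[F]_(m * n).
Proof.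
apply/matrixP => i j; case: (mxtens_indexP i) => i1 i2; case: (mxtens_indexP j) => j1 j2.
rewrite tensmxE !mxE -natrM mulnb; congr (_%:R).
by rewrite (inj_eq (can_inj (@mxtens_indexK m n))) xpair_eqE.
Qed.

Lemma invmx_tens m n (A : 'M[F]_m) (B : 'M[F]_n) :
  A \in unitmx -> B \in unitmx ->
  (A *t B \in unitmx) * (invmx (A *t B) = invmx A *t invmx B).
Proof.
move=> Au Bu; have AB : (A *t B) *m (invmx A *t invmx B) = 1%:M.
  by rewrite tensmx_mul !mulmxV // tens1mx.
have [ABu _] := mulmx1_unit AB; split=> //.
by apply: (can_inj (mulKmx ABu)); rewrite mulmxV // AB.
Qed.

(** In the commutator of X and E both mixed terms equal q^(-2) T and cancel. There remain [X1, E1]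
    (x) K2^-1 and K1 (x) [X2, E2], whose values telescope through K1 (x) K2^-1. *)
Lemma rmodule_qtens (M N : qmod F 1) : qrmodule M -> qrmodule N -> qrmodule (qtens M N).
Proof.
move=> Mm Nm; rewrite /= !linearD /= !trmx_tens !trmx1 trmx_inv.
set E1 := mE M; set X1 := mX M; set K1 := mK M.
set E2 := mE N; set X2 := mX N; set K2 := mK N.
have u1 : K1 \in unitmx := rm_unit Mm; have u2 : K2 \in unitmx := rm_unit Nm.
have [u12 V12] := invmx_tens u1 u2.
have EV := mulmx_invmx_comm u2 (rm_EK Nm); have XV := mulmx_invmx_comm u1 (rm_XK Mm).
split=> //.
- rewrite mulmxDl mulmxDr !tensmx_mul (rm_EK Mm) (rm_EK Nm) -/K1 -/K2 mul1mx mulmx1.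
  by rewrite tensmxZl tensmxZr scalerDr.
- rewrite mulmxDl mulmxDr !tensmx_mul (rm_XK Mm) (rm_XK Nm) -/K1 -/K2 mul1mx mulmx1.
  by rewrite mulVmx // mulmxV // tensmxZl tensmxZr scalerDr.
rewrite !mulmxDl !mulmxDr !tensmx_mul !mul1mx !mulmx1 V12.
have X1K : X1 *m K1 = q ^ (- 2) *: (K1 *m X1) := rm_XK Mm.
have E2V : E2 *m invmx K2 = q ^ (- 2) *: (invmx K2 *m E2) := EV.
rewrite X1K E2V tensmxZl tensmxZr.
set T := (K1 *m X1) *t (invmx K2 *m E2).
have Ma : (X1 *m E1 - E1 *m X1) *t invmx K2 =
    (q - q^-1)^-1 *: (K1 *t invmx K2 - invmx K1 *t invmx K2).
  by rewrite (rm_XE Mm) tensmxZl tensmxDl tensmxNl.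
have Na : K1 *t (X2 *m E2 - E2 *m X2) =
    (q - q^-1)^-1 *: (K1 *t K2 - K1 *t invmx K2).
  by rewrite (rm_XE Nm) tensmxZr tensmxDr tensmxNr.
rewrite tensmxDl tensmxNl in Ma; rewrite tensmxDr tensmxNr in Na.
have -> : (q - q^-1)^-1 *: (K1 *t K2 - invmx K1 *t invmx K2) =
  (q - q^-1)^-1 *: (K1 *t invmx K2 - invmx K1 *t invmx K2) +
  (q - q^-1)^-1 *: (K1 *t K2 - K1 *t invmx K2).
  by rewrite -scalerDr [X in _ = _ *: X]addrC addrA subrK.
rewrite -Ma -Na.
move: (X1 *m E1 *t _) (_ *: T) (E1 *t X2) (K1 *t _) (E1 *m X1 *t _) (K1 *t _).
by move=> A B C D A' D'; apply/matrixP => i j; rewrite !mxE; ring.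
Qed.

(** The tensor products of the string of N with the rows of P form a weight basis, of weights s - 2
    i + a j. *)
Lemma has_weights_qtens (N M : qmod F 1) s D : standard N s -> has_weights M D ->
  has_weights (qtens N M) (fun n : int => \sum_(i < s.+1) D (n - s%:Z + 2 * i%:Z)%R)%N.
Proof.
move=> [Nm Nd [v [v0 vn vE]]] [P [a [Pu PK aD]]].
have Qu := standard_basis Nm Nd v0 vn vE; set Q := strmx _ _ _ in Qu.
have QK : Q *m mK N = string_K (qdim N) s *m Q := strmx_K Nm vn _.
pose b (i : 'I_(qdim N)) : int := s%:Z - 2 * (i : nat)%:Z.
have [c cE] : exists c, forall ij, c (@mxtens_index (qdim N) (qdim M) ij) = b ij.1 + a ij.2.
  exists (fun k => b (mxtens_unindex k).1 + a (mxtens_unindex k).2) => ij.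
  by rewrite mxtens_indexK.
exists (Q *t P), c; split.
- by rewrite (invmx_tens Qu Pu).
- rewrite /= trmx_tens !tensmx_mul QK PK -tensmx_mul; congr (_ *m _).
  apply/matrixP => i j; case: (mxtens_indexP i) => i1 i2; case: (mxtens_indexP j) => j1 j2.
  rewrite tensmxE !mxE cE /= (inj_eq (can_inj (@mxtens_indexK _ _))) xpair_eqE.
  by case: (i1 == j1); case: (i2 == j2); rewrite /= ?mulr0n ?mul0r ?mulr0 ?mulr1n ?expfzDr.
move=> n.
have -> : (\sum_(i < s.+1) D (n - s%:Z + 2 * i%:Z)%R = \sum_(i < qdim N) D (n - b i)%R)%N.
  rewrite -(big_mkord xpredT (fun i => D (n - s%:Z + 2 * i%:Z)%R)) -Nd big_mkord.
  by apply: eq_bigr => i _; congr (D _); rewrite /b; ring.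
have -> : (\sum_(i < qdim N) D (n - b i)%R =
    \sum_(i < qdim N) \sum_(j < qdim M) ((b i + a j)%R == n))%N.
  apply: eq_bigr => i _; rewrite -aD; apply: eq_bigr => j _.
  by rewrite -[in RHS]subr_eq0 -[in LHS]subr_eq0; congr (nat_of_bool (_ == _)); ring.
rewrite pair_big /= (reindex (@mxtens_index _ _)) /=.
  by apply: eq_bigr => -[i j] _; rewrite cE.
by exists (@mxtens_unindex _ _) => x _; rewrite ?mxtens_indexK ?mxtens_unindexK.
Qed.

Lemma rmodule_qtriv : qrmodule (qtriv F 1).
Proof.
split; rewrite /= ?trmx1 ?unitmx1 ?trmx0 ?mulmx0 ?mul0mx ?scaler0 //.
by rewrite invmx1 !subrr scaler0.
Qed.

Lemma standard_qtriv : standard (qtriv F 1) 0.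
Proof.
split; [exact: rmodule_qtriv|by []|exists 1%:M; split].
- by apply/eqP => /matrixP /(_ 0 0); rewrite !mxE; apply/eqP/oner_neq0.
- by rewrite /wt /= trmx1 mulmx1 expr0z scale1r.
- by rewrite /= trmx0 mulmx0.
Qed.

Lemma has_weights_qtriv : has_weights (qtriv F 1) (fun n => (n == 0) : nat).
Proof.
exists 1%:M, (fun=> 0); split; first exact: unitmx1.
  by rewrite /= trmx1 mulmx1 mulmx1; apply/matrixP => i j; rewrite !mxE expr0z.
by move=> n; rewrite big_ord1 eq_sym.
Qed.

(** * Generation by singular vectors *)

(** An injective endomorphism of a finite-dimensional space is onto. *)
Lemma inj_stable_sub d (B Y : 'M[F]_d) : (B *m Y <= B)%MS ->
  (forall u : 'rV_d, (u <= B)%MS -> u *m Y = 0 -> u = 0) -> (B <= B *m Y)%MS.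
Proof.
move=> BY inj; rewrite -(mxrank_leqif_sup BY) -(mxrank_mul_ker B Y).
suff -> : (B :&: kermx Y)%MS = 0 by rewrite mxrank0 addn0.
apply/eqP/rowV0P => u; rewrite sub_capmx => /andP[uB /sub_kermxP uY].
exact: inj.
Qed.

Section Generation.
Variables (d : nat) (E X K : 'M[F]_d).
Hypothesis EXK : rmodule E X K.

Local Notation eig n := (eigenspace K (q ^ n)).

Lemma eigP n (u : 'rV_d) : reflect (wt K n u) (u <= eig n)%MS.
Proof. exact: eigenspaceP. Qed.

Lemma eig_E n : (eig n *m E <= eig (n + 2))%MS.
Proof.
apply/row_subP => i; rewrite row_mul; apply/eigP/(wtE EXK)/eigP; exact: row_sub.
Qed.

Lemma eig_X n : (eig n *m X <= eig (n - 2))%MS.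
Proof.
apply/row_subP => i; rewrite row_mul; apply/eigP/(wtX EXK)/eigP; exact: row_sub.
Qed.

Lemma eig_XE n : 0 < n -> (eig n <= eig n *m X *m E)%MS.
Proof.
move=> n0; rewrite -mulmxA; apply: inj_stable_sub.
  rewrite mulmxA; apply: submx_trans (submxMr _ (eig_X n)) _.
  by apply: submx_trans (eig_E _) _; rewrite subrK.
by move=> u /eigP un; rewrite mulmxA; exact: (wt_XE_inj EXK n0 un).
Qed.

Lemma eig_EX n : n < 0 -> (eig n <= eig n *m E *m X)%MS.
Proof.
move=> n0; rewrite -mulmxA; apply: inj_stable_sub.
  rewrite mulmxA; apply: submx_trans (submxMr _ (eig_E n)) _.
  by apply: submx_trans (eig_X _) _; rewrite addrK.
by move=> u /eigP un; rewrite mulmxA; exact: (wt_EX_inj EXK n0 un).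
Qed.

(** M_(n+2) = M_(n+2) X E lies in M_n E, so E maps M_n onto M_(n+2); the rest is rank-nullity. *)
Lemma rank_singular (n : nat) :
  (\rank (eig n :&: kermx E) + \rank (eig (n%:Z + 2)))%N = \rank (eig n).
Proof.
rewrite -(mxrank_mul_ker (eig n) E) addnC; congr (_ + _)%N.
suff /eqmxP -> : (eig n *m E == eig (n%:Z + 2))%MS by [].
rewrite eig_E; apply: submx_trans (eig_XE (_ : 0 < n%:Z + 2)) _; first by lia.
apply: submxMr; apply: submx_trans (eig_X _) _.
by rewrite addrK.
Qed.

(* For n >= 0 a vector of weight n is, up to a singular vector, the image under
   X of one of weight n + 2; for n < 0 no correction is needed. *)
Lemma singular_generate m (Z : 'M[F]_(m, d)) (B : int) :
  (Z *m X <= Z)%MS -> (forall n, B <= n -> eig n = 0) ->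
  (forall n : nat, (eig n :&: kermx E <= Z)%MS) -> forall n, (eig n <= Z)%MS.
Proof.
move=> ZX eB sZ; suff gen (k : nat) n : B <= n + 2 * k%:Z -> (eig n <= Z)%MS.
  by move=> n; apply: (gen `|B - n|%N); lia.
elim: k n => [|k IH] n Bn; first by rewrite eB ?sub0mx //; lia.
have e2 : (eig (n + 2) <= Z)%MS by apply: IH; lia.
have [n0|n0] := ltP n 0.
  apply: submx_trans (eig_EX n0) _; apply: submx_trans ZX.
  by apply: submxMr; apply: submx_trans (eig_E n) e2.
apply/row_subP => i; set u := row i _.
have un : (u <= eig n)%MS by exact: row_sub.
have : (u *m E <= eig (n + 2) *m X *m E)%MS.
  apply: submx_trans (eig_XE _); last by lia.
  exact: submx_trans (submxMr _ un) (eig_E n).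
case/submxP => c; rewrite 2!(mulmxA c); set y := c *m eig (n + 2) => uE.
have y2 : (y <= eig (n + 2))%MS by rewrite /y submxMl.
rewrite -(subrK (y *m X) u) addmx_sub //; last first.
  by apply: submx_trans ZX; apply: submxMr; exact: submx_trans y2 e2.
have := sZ `|n|%N; rewrite gez0_abs //; apply: submx_trans; rewrite sub_capmx; apply/andP; split.
  rewrite addmx_sub // eqmx_opp; apply: submx_trans (submxMr _ y2) _.
  by apply: submx_trans (eig_X _) _; rewrite addrK.
by apply/sub_kermxP; rewrite mulmxBl uE subrr.
Qed.

End Generation.

(** * Complete reducibility and multiplicities *)

(** For f n = dim M_n, r n counts the copies of V_n. Beyond all weights the terms with f k.+1 and f
    k.+2 vanish; then the left side is the dimension of the sum of simple modules and, weights being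
    symmetric, the right side is dim M. *)
Lemma summation_by_parts (f r : nat -> nat) k :
  (forall n, r n + f n.+2 = f n)%N ->
  (\sum_(n < k.+1) n.+1 * r n + k.+1 * f k.+2 + k * f k.+1
   = \sum_(n < k.+1) (if n == 0 :> nat then f 0 else 2 * f n))%N.
Proof.
move=> fr; elim: k => [|k IH].
  by rewrite !big_ord1 /= mul0n addn0 !mul1n fr.
rewrite big_ord_recr [RHS]big_ord_recr /= -IH -(fr k.+1); ring.
Qed.

Lemma qdim_qsum_seq (s : seq (qmod F 1)) :
  qdim (qsum_seq s) = (\sum_(M <- s) qdim M)%N.
Proof. by elim: s => [|M s IH]; rewrite ?big_nil ?big_cons //= IH. Qed.

Lemma qiso_qdim (M N : qmod F 1) : qiso M N -> qdim M = qdim N.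
Proof. by case/qiso_rhom => f [_ /eqP fM /eqP fN]; apply: etrans fN. Qed.

(** Each listed singular vector receives its own simple summand; the direct sum maps to M by
    [standard_rhom] on each of them. *)
Lemma rhom_qsum_seq (N : nat -> qmod F 1) (M : qmod F 1) (l : seq (nat * 'rV_(qdim M))) :
  (forall x, x \in l -> standard (N x.1) x.1) -> qrmodule M ->
  (forall x, x \in l -> x.2 != 0 /\ (x.2 <= sing M x.1)%MS) ->
  exists f : 'M_(qdim (qsum_seq [seq N x.1 | x <- l]), qdim M),
    rhom f /\ forall x, x \in l -> (x.2 <= f)%MS.
Proof.
move=> Ns Mm; elim: l Ns => [|[n u] l IH] Ns ls.
  by exists 0; split => //; split; rewrite ?mul0mx ?mulmx0.
have [x xl|x xl|f [[fE fX fK] fl]] := IH.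
- by apply: Ns; rewrite inE xl orbT.
- by apply: ls; rewrite inE xl orbT.
have [u0 /singP[un uE]] : u != 0 /\ (u <= sing M n)%MS by apply: (ls (n, u)); exact: mem_head.
have [g [[gE gX gK] _ ug]] := standard_rhom (Ns (n, u) (mem_head _ _)) Mm u0 un uE.
exists (col_mx g f); split.
  by split; rewrite /= tr_block_mx !trmx0 mul_block_col !mul0mx addr0 add0r mul_col_mx
    ?gE ?gX ?gK ?fE ?fX ?fK.
move=> x; rewrite inE => /orP[/eqP -> /=|/fl xf].
  by apply: submx_trans ug _; rewrite -addsmxE addsmxSl.
by apply: submx_trans xf _; rewrite -addsmxE addsmxSr.
Qed.

Lemma map_const_nseq (T U : Type) (c : U) (s : seq T) : [seq c | _ <- s] = nseq (size s) c.
Proof. by elim: s => //= _ s ->. Qed.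

Section Decomposition.
Variables (M V : qmod F 1) (N : nat -> qmod F 1) (D : int -> nat) (lam : nat).
Hypotheses (Mm : qrmodule M) (MD : has_weights M D) (DN : forall n, D (- n) = D n).
Hypotheses (Ns : forall n, standard (N n) n) (Vs : standard V lam).

Lemma rank_sing (n : nat) : (\rank (sing M n) + D (n%:Z + 2))%N = D n.
Proof.
have := rank_singular Mm n.
by rewrite -!/(weight_dim q M _) !(has_weights_dim _ MD).
Qed.

Definition sing_items (n : nat) : seq (nat * 'rV[F]_(qdim M)) :=
  [seq (n, row i (row_base (sing M n))) | i <- enum 'I_(\rank (sing M n))].

Lemma sing_itemsP n x : x \in sing_items n ->
  [/\ x.1 = n, x.2 != 0 & (x.2 <= sing M x.1)%MS].
Proof.
case/mapP => i _ ->; split=> //=; last first.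
  by rewrite -(eq_row_base (sing M n)); exact: row_sub.
apply/eqP => r0; have := row_base_free (sing M n); rewrite -kermx_eq0 => /eqP k0.
have : ((delta_mx 0 i : 'rV[F]__) <= kermx (row_base (sing M n)))%MS.
  by apply/sub_kermxP; rewrite -rowE.
rewrite k0 submx0 => /eqP/rowP/(_ i)/eqP.
by rewrite !mxE !eqxx oner_eq0.
Qed.

(** The direct sum of simple modules, one for each basis singular vector, maps onto M because
    singular vectors generate; equality of dimensions makes the map an isomorphism. *)
Lemma decomposes_with_rank : decomposes_with q M V (\rank (sing M lam)).
Proof.
have [P [a [Pu PK aD]]] := MD.
(* [B] exceeds [lam] and every |a i|, so no weight of M reaches it. *)
pose k := (lam + \sum_i `|a i|)%N; pose B := k.+1.
have aB i : (`|a i| < B)%N.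
  by rewrite ltnS /k (bigD1 i) //= addnCA leq_addr.
have lB : (lam < B)%N by rewrite ltnS leq_addr.
have DB n : B%:Z <= n -> D n = 0%N.
  by move=> Bn; rewrite -aD big1 // => i _; case: eqP => // ai; have := aB i; lia.
pose others := flatten [seq sing_items n | n <- iota 0 B & n != lam].
pose l := sing_items lam ++ others.
(* V itself is used at weight [lam], so that those summands are literally copies of V. *)
pose N' n := if n == lam then V else N n.
have Ns' n : standard (N' n) n by rewrite /N'; case: eqP => [->|].
have othersP x : x \in others -> x \in sing_items x.1 /\ x.1 != lam.
  case/flatten_mapP => n; rewrite mem_filter => /andP[nl _] xn.
  by have [xE _ _] := sing_itemsP xn; rewrite xE.
have items_l n w : (n < B)%N -> (n, w) \in sing_items n -> (n, w) \in l.
  move=> nB; rewrite mem_cat; case: (eqVneq n lam) => [-> -> //|nl inn].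
  apply/orP; right; apply/flatten_mapP; exists n => //.
  by rewrite mem_filter nl mem_iota add0n.
have lP x : x \in l -> x.2 != 0 /\ (x.2 <= sing M x.1)%MS.
  by rewrite mem_cat => /orP[|/othersP[+ _]] => /sing_itemsP[].
have [f [fh fl]] := rhom_qsum_seq (fun x _ => Ns' x.1) Mm lP.
have full : row_full f.
  have [fE fX fK] := fh.
  have gen : forall n, (eigenspace (mK M) (q ^ n) <= f)%MS.
    apply: (singular_generate Mm (B := B)) => [|n Bn|n].
    - by rewrite -fX submxMl.
    - by apply/eqP; rewrite -mxrank_eq0 -/(weight_dim q M n) (has_weights_dim _ MD) DB.
    rewrite -/(sing M n) -(eq_row_base (sing M n)); apply/row_subP => i.
    have inn : (n, row i (row_base (sing M n))) \in sing_items n.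
      by apply: map_f; rewrite mem_enum.
    apply: (fl (n, _)); apply: items_l inn; rewrite ltnNge; apply/negP => Bn.
    have := rank_sing n; rewrite (DB n%:Z) // => /eqP.
    by rewrite addn_eq0 => /andP[/eqP r0 _]; have := ltn_ord i; rewrite [X in (_ < X)%N]r0.
  rewrite -col_leq_rank -{1}(mxrank_unit Pu) mxrankS //; apply/row_subP => i.
  apply: submx_trans (gen (a i)); apply/eigenspaceP.
  by rewrite -row_mul PK row_mul row_diag_mx mxE -scalemxAl -rowE.
have dimE : qdim (qsum_seq [seq N' x.1 | x <- l]) = qdim M.
  rewrite qdim_qsum_seq big_map.
  under eq_bigr => x _ do rewrite (let: And3 _ e _ := Ns' x.1 in e).
  have item n : (\sum_(x <- sing_items n) x.1.+1 = n.+1 * \rank (sing M n))%N.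
    by rewrite big_map big_enum /= sum_nat_const card_ord mulnC.
  transitivity (\sum_(0 <= n < B) n.+1 * \rank (sing M n))%N.
    rewrite big_cat item /others big_flatten big_map big_filter.
    rewrite [RHS](bigD1_seq lam) ?iota_uniq ?mem_index_iota //= /index_iota subn0.
    by congr addn; apply: eq_bigr => n _; exact: item.
  rewrite big_mkord /B.
  have fr (n : nat) : (\rank (sing M n) + D n.+2%:Z = D n)%N.
    by rewrite -[RHS]rank_sing; congr (_ + D _)%N; lia.
  have := summation_by_parts k fr.
  rewrite (DB k.+2%:Z) ?(DB k.+1%:Z) ?muln0 ?addn0; try by rewrite /B; lia.
  move=> ->; rewrite -[RHS]card_ord -sum1_card.
  (* The weight basis is counted by absolute weight: n = 0 gives D 0, and n > 0 gives D n + D (- n)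
     = 2 D n. *)
  under [RHS]eq_bigr => i _.
    have -> : 1%N = (\sum_(n < k.+1) (`|a i| == n))%N.
      rewrite (bigD1 (Ordinal (aB i))) //= eqxx big1 ?addn0 // => n ni.
      by rewrite eq_sym (_ : (n == `|a i|%N :> nat) = false) //; apply/negbTE.
    over.
  rewrite exchange_big; apply: eq_bigr => n _ /=.
  have [n0|n0] := eqVneq (n : nat) 0%N.
    rewrite -aD; apply: eq_bigr => i _; congr (nat_of_bool _); rewrite n0; lia.
  rewrite mul2n -addnn -{1}DN -!aD -big_split; apply: eq_bigr => i _ /=.
  by have := n0; case: (a i) => j; lia.
have free : row_free f by rewrite /row_free (eqP full) dimE.
have Miso : qiso M (qsum_seq [seq N' x.1 | x <- l]).
  by apply: qiso_sym; apply/qiso_rhom; exists f.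
pose t := [seq N' x.1 | x <- others].
exists (size t), (tnth (in_tuple t)); split; last first.
  rewrite codomE map_tnth_enum /=; move: Miso; rewrite /l map_cat.
  suff -> : [seq N' x.1 | x <- sing_items lam] = nseq (\rank (sing M lam)) V by [].
  rewrite -map_comp (eq_map (_ : _ =1 fun=> V)) ?map_const_nseq ?size_enum_ord //.
  by move=> i /=; rewrite /N' eqxx.
move=> i; have io : (i < size others)%N by apply: leq_trans (ltn_ord i) _; rewrite size_map.
rewrite (tnth_nth V) /= (nth_map (0%N, 0)) //; set x := nth _ _ _.
have [_ xl] := othersP x (mem_nth _ io); rewrite /N' (negbTE xl).
have Nx := Ns x.1; split.
- by apply: rmodule_is_qmodule; case: Nx.
- exact: standard_irreducible Nx.
- move/qiso_qdim; have [_ Nd _] := Nx; have [_ Vd _] := Vs.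
  by rewrite Nd Vd => -[/eqP]; rewrite (negbTE xl).
Qed.

Lemma multiplicity_is_rank : multiplicity_is q M V (\rank (sing M lam)).
Proof.
move=> m; split=> [/(decomposes_with_sing Vs) //|->].
exact: decomposes_with_rank.
Qed.

End Decomposition.

(** * Restriction to the classical subalgebra and conclusion *)

(** E raises the weight to n + 2, which the highest-weight condition excludes. *)
Lemma highest_weight_vector (M : qmod F 1) n : qrmodule M -> has_highest_weight q M n ->
  exists v, [/\ v != 0, wt (mK M) n v & v *m mE M = 0].
Proof.
move=> Mm [n0 nmax].
have /rowV0Pn[v vn v0] : eigenspace (mK M) (q ^ n) != 0 by rewrite -mxrank_eq0.
have vwt : wt (mK M) n v by exact/eigenspaceP.
exists v; split => //; apply/eqP; apply: contraT => vE.
have /nmax[k] : weight_dim q M (n + 2) != 0%N.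
  rewrite mxrank_eq0; apply/rowV0Pn; exists (v *m mE M) => //.
  exact/eigenspaceP/(wtE Mm).
by lia.
Qed.

Lemma rmodule_classical (M : qmod F 2) :
  is_qmodule q cartan_affine_sl2 M -> qrmodule (classical M).
Proof.
case=> Ku _ Ke Kf ef _ _; split; rewrite ?unitmx_tr //=.
- by rewrite -!trmx_mul Ke mxE eqxx linearZ.
- by rewrite -!trmx_mul Kf mxE eqxx linearZ.
- by rewrite -!trmx_mul -[LHS]linearB /= ef eqxx linearZ /= raddfB /= trmx_inv.
Qed.

Lemma classical_qtens_seq (s : seq (qmod F 2)) :
  classical (qtens_seq s) = qtens_seq [seq classical M | M <- s].
Proof. by elim: s => //= M s <-. Qed.

Section Tensor.
Variable N : nat -> qmod F 1.

Lemma rmodule_tensor (l : seq nat) : {in l, forall s, qrmodule (N s)} ->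
  qrmodule (qtens_seq [seq N s | s <- l]).
Proof.
elim: l => [|s l IH] Nl; first exact: rmodule_qtriv.
apply: rmodule_qtens; first by apply: Nl; exact: mem_head.
by apply: IH => x xl; apply: Nl; rewrite inE xl orbT.
Qed.

Lemma has_weights_tensor (l : seq nat) : {in l, forall s, standard (N s) s} ->
  has_weights (qtens_seq [seq N s | s <- l]) (tensor_mult l).
Proof.
elim: l => [|s l IH] Nl; first exact: has_weights_qtriv.
apply: has_weights_qtens; first by apply: Nl; exact: mem_head.
by apply: IH => x xl; apply: Nl; rewrite inE xl orbT.
Qed.

End Tensor.
End QuantumSl2.

Lemma fseq_list_gt0 (nu : fseq) s : s \in fseq_list nu -> (0 < s)%N.
Proof.
case/flattenP => _ /mapP[t + ->]; rewrite mem_fsupp => nt /nseqP[-> _].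
by rewrite lt0n; apply: contraNneq nt => ->; rewrite fseq0.
Qed.

Theorem theorem4p9 (F : fieldType) (q : F) (q_neq0 : q != 0)
  (q_generic : forall n : nat, (0 < n)%N -> q ^+ n != 1)
  (W : nat -> qmod F 2)
  (W_mod : forall s : nat, (0 < s)%N -> is_qmodule q cartan_affine_sl2 (W s))
  (W_irr : forall s : nat, (0 < s)%N -> irreducible (W s))
  (W_dim : forall s : nat, (0 < s)%N -> qdim (W s) = s.+1)
  (W_hw : forall s : nat, (0 < s)%N ->
     has_highest_weight q (classical (W s)) s%:Z)
  (nu : fseq) :
  [/\ Rseries nu = character q (classical (Wtensor W nu)),
      (forall lambda : int,
         \sum_(N \in at_weight nu lambda) Rnum nu N
         = (weight_dim q (classical (Wtensor W nu)) lambda)%:R)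
    & weyl (Rseries nu) = Rseries nu]
  /\
  [/\ Kseries nu = smul (xpow 0 \- xpow (- 2))
                        (character q (classical (Wtensor W nu))),
      (forall (lambda : nat) (V : qmod F 1),
         is_qmodule q cartan_sl2 V -> irreducible V ->
         has_highest_weight q V lambda%:Z ->
         exists m : nat,
           multiplicity_is q (classical (Wtensor W nu)) V m /\
           \sum_(N \in at_weight nu lambda%:Z) Knum nu N = m%:R)
    & weyl (smul (xpow 1) (Kseries nu)) = \- smul (xpow 1) (Kseries nu)].
Proof.
(* The hypotheses on W start at s = 1; the trivial module fills in V_0, so that a simple module of
   each highest weight is at hand. *)
pose N s := if s is 0%N then qtriv F 1 else classical (W s).
have Ns s : standard q (N s) s.
  case: s => [|s]; first exact: standard_qtriv.
  have Wm := rmodule_classical (W_mod s.+1 isT).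
  split => //; first exact: W_dim.
  exact: (highest_weight_vector q_neq0 Wm (W_hw s.+1 isT)).
set M := classical (Wtensor W nu).
have ME : M = qtens_seq [seq N s | s <- fseq_list nu].
  rewrite /M /Wtensor classical_qtens_seq; congr qtens_seq.
  have -> : flatten [seq nseq (nu s) (W s) | s <- fsupp nu] = [seq W s | s <- fseq_list nu].
    rewrite /fseq_list map_flatten -map_comp; congr flatten.
    by apply: eq_map => s /=; rewrite map_nseq.
  rewrite -map_comp; apply/eq_in_map => s /fseq_list_gt0.
  by case: s.
have MD : has_weights q M (tensor_mult (fseq_list nu)).
  by rewrite ME; apply: (has_weights_tensor q_neq0 q_generic) => s _; exact: Ns.
have Mm : rmodule q (qe M 0)^T (qf M 0)^T (qk M 0)^T.
  by rewrite ME; apply: (rmodule_tensor q_neq0) => s _; have [] := Ns s.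
have dimM n : weight_dim q M n = tensor_mult (fseq_list nu) n.
  exact: (has_weights_dim q_neq0 q_generic _ MD).
clearbody M; split; split.
- by apply/funext => n; rewrite RseriesE /character dimM.
- by move=> n; rewrite dimM sum_Rnum.
- by apply/funext => n; rewrite /weyl !RseriesE tensor_multN.
- apply/funext => n; rewrite KseriesE smul_xpowB /character !dimM subr0.
  by rewrite opprK.
- move=> lambda V /is_qmodule_rmodule Vm Virr Vhw.
  have [v [v0 vn vE]] := highest_weight_vector q_neq0 Vm Vhw.
  have [m [lm] Vs] := irreducible_standard q_neq0 q_generic Vm Virr v0 vn vE.
  rewrite -{m}lm in Vs.
  exists (\rank (sing q M lambda)); split.
    exact: (multiplicity_is_rank q_neq0 q_generic Mm MD (@tensor_multN _) Ns Vs).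
  rewrite sum_Knum -(rank_sing q_neq0 q_generic Mm MD) natrD addrK //.
(* The coefficient of x^n in x K(nu) is D(n - 1) - D(n + 1), which is odd in n because D is even. *)
- apply/funext => n; change (\- _)%R with (fun n => - smul (xpow 1) (Kseries nu) n).
  rewrite /weyl !smul_xpow !KseriesE opprB.
  rewrite -[tensor_mult _ (- n - 1)]tensor_multN -[tensor_mult _ (- n - 1 + 2)]tensor_multN.
  by congr ((tensor_mult _ _)%:R - (tensor_mult _ _)%:R); lia.
Qed.
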